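(* Let $D\in\mathbb{R}^{m\times n}$, $S\in\mathcal{S}(D)$, $a>0$, $\eta\in(0,1)$, $t\in(0,(n-1)/2-\log(2(n-r_S)))$, and choose $$\lambda_0\ge\frac{1}{1-\eta}\,\gamma\sqrt{\frac{2\log(2(n-r_S))+2t}{n-1}} .$$ Assume that $n>8a$, that $\lambda_0\ge R/(1-\eta)$ for some $R>0$, that $$\|Df^0\|_1\le \frac{c\,\sigma\sqrt{1-\sqrt{8a/n}}}{\lambda_0},\qquad c=\sqrt{\left(\frac{\eta}{2}-\frac{\sqrt{r_S}+\sqrt{2a}}{\sqrt{n-\sqrt{8an}}}\right)^2+4}-2,$$ and that $S$ satisfies $$\eta>2\,\frac{\sqrt{r_S}+\sqrt{2a}}{\sqrt{n-\sqrt{8an}}} .$$ Then for all $f\in\mathbb{R}^n$ it holds that, with probability at least $1-4e^{-a}-e^{-t}$, $$\|\hat f_{\sqrt{}}-f^0\|_n^2+2(1-\eta)\sqrt{1-\sqrt{\frac{8a}{n}}}\,\sigma\lambda_0\|D_S\hat f_{\sqrt{}}\|_1\le\|f-f^0\|_n^2+\frac{\sigma^2}{n}\left(\sqrt{2a}+\sqrt{r_S}\right)^2+16\sigma\lambda_0\|Df\|_1 .$$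
   Context: Model: $f^0\in\mathbb{R}^n$ is a fixed signal and one observes $Y=f^0+\epsilon$ with $\epsilon\sim\mathcal{N}_n(0,\sigma^2 \mathrm{I}_n)$, $\sigma\in(0,\infty)$. For $f\in\mathbb{R}^n$, $\|f\|_n^2=\sum_{i=1}^n f_i^2/n$. The square root analysis estimator is $\hat f_{\sqrt{}}=\arg\min_{f\in\mathbb{R}^n}\{\|Y-f\|_n+\lambda_0\|Df\|_1\}$, $\lambda_0>0$. Active sets: $[m]=\{1,\dots,m\}$; $d_i'$ is the $i$-th row of $D$. For $S\subseteq[m]$, $-S=[m]\setminus S$, $s=|S|$, and $D_S$, $D_{-S}$ are the submatrices of $D$ with rows indexed by $S$, $-S$. Put $S(f)=\{j\in[m]: d_j'f\neq0\}$ and $\mathcal{S}(D)=\{S\subseteq[m]:\exists f\in\mathbb{R}^n,\ S=S(f)\}$. $r_S=\dim \mathcal{N}(D_{-S})$, the dimension of the nullspace of $D_{-S}$. Scaling factor: let $D_{-S}^+\in\mathbb{R}^{n\times(m-s)}$ be the Moore–Penrose pseudoinverse of $D_{-S}$, with columns $d_1^+,\dots,d_{m-s}^+$. Then $\gamma=\max_{i\in[m-s]}\|d_i^+\|_n$. *)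

(* Defs.v *)
From HB Require Import structures.
From mathcomp Require Import all_boot all_order all_algebra.
From mathcomp Require Import all_classical all_reals all_analysis.

Set Implicit Arguments.
Unset Strict Implicit.
Unset Printing Implicit Defensive.

Import Order.TTheory GRing.Theory Num.Theory.

Local Open Scope classical_set_scope.
Local Open Scope ring_scope.

Definition norm1 (R : realType) (k : nat) (v : 'cV[R]_k) : R :=
  \sum_(i < k) `|v i 0|.

Definition normn (R : realType) (n : nat) (v : 'cV[R]_n) : R :=
  Num.sqrt (\sum_(i < n) v i 0 ^+ 2 / n%:R).

Definition rows (R : realType) (m n : nat) (D : 'M[R]_(m, n)) (S : {set 'I_m}) :
    'M[R]_(#|S|, n) :=
  rowsub (fun i : 'I_#|S| => enum_val i) D.

Definition active (R : realType) (m n : nat) (D : 'M[R]_(m, n))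
    (f : 'cV[R]_n) : {set 'I_m} :=
  [set j | (D *m f) j 0 != 0]%SET.

Definition active_sets (R : realType) (m n : nat) (D : 'M[R]_(m, n)) :
    set {set 'I_m} :=
  [set S | exists f : 'cV[R]_n, S = active D f].

(* [kermx] is the kernel for the action on row vectors, hence the transpose. *)
Definition nullity (R : realType) (k n : nat) (A : 'M[R]_(k, n)) : nat :=
  \rank (kermx A^T).

Definition r_ (R : realType) (m n : nat) (D : 'M[R]_(m, n))
    (S : {set 'I_m}) : nat :=
  nullity (rows D (~: S)%SET).

Definition is_moore_penrose (R : realType) (m n : nat)
    (A : 'M[R]_(m, n)) (X : 'M[R]_(n, m)) : Prop :=
  [/\ A *m X *m A = A, X *m A *m X = X,
      (A *m X)^T = A *m X & (X *m A)^T = X *m A].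

(* Computed from the full-rank factorization A = C F as
   F^T (F F^T)^-1 (C^T C)^-1 C^T; see [mpinvP] and [mpinv_unique]. *)
Definition mpinv (R : realType) (m n : nat) (A : 'M[R]_(m, n)) : 'M[R]_(n, m) :=
  let C := col_base A in let F := row_base A in
  F^T *m invmx (F *m F^T) *m (invmx (C^T *m C) *m C^T).

Lemma row_free_gram (R : realType) (m n : nat) (A : 'M[R]_(m, n)) :
  row_free A -> A *m A^T \in unitmx.
Proof.
move=> Afree; rewrite -row_free_unit; apply/row_freeP.
suff /row_freeP : row_free (A *m A^T) by [].
rewrite -kermx_eq0; apply/eqP/row_matrixP => i; rewrite row0.
set v := row i _.
have vAA : v *m A *m A^T = 0.
  by rewrite -mulmxA /v -row_mul mulmx_ker row0.
have vA : v *m A = 0.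
  have /matrixP/(_ 0 0) : v *m A *m (v *m A)^T = 0.
    by rewrite trmx_mul mulmxA vAA mul0mx.
  rewrite !mxE => /eqP; rewrite psumr_eq0; last first.
    by move=> j _; rewrite !mxE -expr2 sqr_ge0.
  move=> /allP h; apply/rowP => j; rewrite [RHS]mxE.
  have := h j (mem_index_enum j); rewrite [X in _ * X]mxE /= mulf_eq0 orbb.
  by move/eqP.
by apply: (row_free_inj Afree); rewrite vA mul0mx.
Qed.

Lemma full_rank_moore_penrose (R : realType) (m n r : nat)
    (C : 'M[R]_(m, r)) (F : 'M[R]_(r, n)) :
  C^T *m C \in unitmx -> F *m F^T \in unitmx ->
  is_moore_penrose (C *m F)
    (F^T *m invmx (F *m F^T) *m (invmx (C^T *m C) *m C^T)).
Proof.
move=> uC uF; set X := F^T *m _ *m _.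
have FX : F *m X = invmx (C^T *m C) *m C^T.
  by rewrite /X !(mulmxA F) mulmxV // mul1mx.
have XC : X *m C = F^T *m invmx (F *m F^T).
  by rewrite /X -mulmxA -(mulmxA (invmx _)) mulVmx // mulmx1.
have symC : (invmx (C^T *m C))^T = invmx (C^T *m C).
  by rewrite trmx_inv trmx_mul trmxK.
have symF : (invmx (F *m F^T))^T = invmx (F *m F^T).
  by rewrite trmx_inv trmx_mul trmxK.
split.
- rewrite -(mulmxA C) FX -mulmxA -(mulmxA (invmx _)) (mulmxA C^T).
  by rewrite (mulmxA (invmx _)) mulVmx // mul1mx.
- by rewrite mulmxA XC -mulmxA FX.
- by rewrite -mulmxA FX !trmx_mul trmxK symC mulmxA.
- by rewrite mulmxA XC !trmx_mul trmxK symF mulmxA.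
Qed.

Lemma mpinvP (R : realType) (m n : nat) (A : 'M[R]_(m, n)) :
  is_moore_penrose A (mpinv A).
Proof.
rewrite -[X in is_moore_penrose X]mulmx_base; apply: full_rank_moore_penrose.
  rewrite -{2}[col_base A]trmxK; apply: row_free_gram.
  by rewrite /row_free mxrank_tr; exact: col_base_full.
exact/row_free_gram/row_base_free.
Qed.

Lemma mpinv_unique (R : realType) (m n : nat) (A : 'M[R]_(m, n))
    (X : 'M[R]_(n, m)) :
  is_moore_penrose A X -> X = mpinv A.
Proof.
have [] := mpinvP A; set Y := mpinv A => y1 y2 y3 y4 [x1 x2 x3 x4].
have AXY : A *m X = A *m Y.
  rewrite -[LHS]x3 -[in LHS]y1 -(mulmxA (A *m Y)) trmx_mul x3 y3.
  by rewrite mulmxA x1.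
have XAY : X *m A = Y *m A.
  rewrite -[LHS]x4 -[in LHS]y1 -(mulmxA A) mulmxA trmx_mul x4 y4.
  by rewrite -(mulmxA Y) (mulmxA A) x1.
by rewrite -x2 XAY -mulmxA AXY mulmxA y2.
Qed.

(* The norms are nonnegative, so the base value 0 only matters if S = [m]. *)
Definition gamma_ (R : realType) (m n : nat) (D : 'M[R]_(m, n))
    (S : {set 'I_m}) : R :=
  \big[Num.max/0]_(i < #|(~: S)%SET|) normn (col i (mpinv (rows D (~: S)%SET))).

(* The minimizer need not be unique a priori: [fhat] is any of them. *)
Definition sqrt_analysis_estimator (R : realType) (m n : nat)
    (D : 'M[R]_(m, n)) (lambda0 : R) (Y fhat : 'cV[R]_n) : Prop :=
  forall f : 'cV[R]_n,
    normn (Y - fhat) + lambda0 * norm1 (D *m fhat)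
    <= normn (Y - f) + lambda0 * norm1 (D *m f).

(* eps ~ N_n(0, sigma^2 I_n): the joint law is the n-fold product of
   N(0, sigma^2); the second parameter of [normal_prob] is the standard
   deviation. *)
Definition gaussian_noise (d : measure_display) (T : measurableType d)
    (R : realType) (P : probability T R) (n : nat) (sigma : R)
    (eps : 'I_n -> {RV P >-> R}) : Prop :=
  forall B : 'I_n -> set R, (forall i, measurable (B i)) ->
    P (\bigcap_(i in [set: 'I_n]) (eps i @^-1` B i))
    = (\prod_(i < n) normal_prob 0 sigma (B i))%E.

Definition noise_vec (d : measure_display) (T : measurableType d)
    (R : realType) (P : probability T R) (n : nat)
    (eps : 'I_n -> {RV P >-> R}) (w : T) : 'cV[R]_n :=
  \col_i eps i w.

(* [Q] need not be measurable (it involves an arbitrary selection of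
   minimizers), so a measurable event on which it holds is required; for
   measurable [Q] this says p <= P Q. *)
Definition with_proba_ge (d : measure_display) (T : measurableType d)
    (R : realType) (P : probability T R) (p : R) (Q : set T) : Prop :=
  exists A : set T, [/\ measurable A, A `<=` Q & (p%:E <= P A)%E].

(* Main.v *)
Require Import Defs.
From HB Require Import structures.
From mathcomp Require Import all_boot all_order all_algebra.
From mathcomp Require Import all_classical all_reals all_analysis.
From mathcomp Require Import measurable_realfun perm.
From mathcomp Require Import ring lra.

(** Let [A] be the submatrix of the rows of [D] outside [S], [P] the orthogonal
  projector onto [ker A], whose rank is [r_ D S], and [e] the noise. Every
  vector is [v = P v + A^+ (A v)], so that, with [d_i^+] the columns of [A^+],
     <e, v> = <P e, v> + sum_i (A v)_i <d_i^+, e>.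

  Suppose first that the last sum is at most
  [(1 - eta) * lambda0 * n * normn e * norm1 (A v)] for all [v], and that
  [normn (P e)] and [normn e] have their typical sizes. Convexity of the
  criterion on the segment from [f0] to [fhat] then gives
  [normn (fhat - f0) <= eta * normn e] ([estimation_error_small]): the smallness
  of [norm1 (D *m f0)] through the constant [c] is exactly what excludes a point
  of the segment at distance [eta * normn e]. Hence the residual has norm
  between [(1 - eta) * normn e] and [(1 + eta) * normn e]; in particular it is
  not zero, the norm is differentiable there, and the first order condition for
  [fhat] ([optimality]) turns into the oracle inequality ([oracle_inequality]):
  the projected noise is absorbed by the square of [normn (fhat - f)], and the
  sum over the rows of [A] by the penalty.

  The sizes of [normn (P e)] and [normn e] are Chernoff bounds for chi-square
  variables ([proj_upper_tail], [chi2_lower_tail], [chi2_crude_tail]). The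
  delicate point is the sum over the rows of [A]: the number of these rows may
  exceed the rank [q = n - r_ D S] of [A] by far, but only [ln (2 q)] is
  available, which a union bound over the rows does not give. The remedy is that
  Auerbach's lemma provides weights [h_i] of total mass at most [q] such that
  [|(A v)_i| <= h_i * norm1 (A v)] ([auerbach]). By convexity of [cosh], the
  cosh of the sum divided by [norm1 (A v)] is at most
  [sum_i h_i * cosh <d_i^+, e>] for all [v] simultaneously, and so it is after
  scaling
  ([weighted_cosh_bound]), and Markov's inequality for this single variable
  costs a factor [2 q] ([spherical_sup_tail]).

  Since the noise enters only through its direction [e / |e|], this requires
  the moment bound [E cosh (m <b, e> / |e|) <= exp (m^2 |b|^2 / (2 (n - 1)))]
  ([spherical_cosh]). As [y |-> cosh (c * sqrt y)] is convex, and [|e|] is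
  independent of the direction, it follows from Jensen's inequality and the
  Gaussian Laplace transform. The independence is used only in the form of the
  identity [gaussian_dilation], obtained from the behaviour of the Gaussian
  density under dilations. *)

Set Implicit Arguments.
Unset Strict Implicit.
Unset Printing Implicit Defensive.

Import Order.TTheory GRing.Theory Num.Theory.
Import numFieldNormedType.Exports.
Import HBNNSimple.

Local Open Scope classical_set_scope.
Local Open Scope ring_scope.

(** * Measures with a density *)

(** Change of density for integrals of nonnegative functions, by approximation
  from below with simple functions. It is stated as an existence result so
  that densities can be introduced inside proofs. *)
Lemma density_measure (R : realType) (d : measure_display)
  (T : measurableType d)
  (mu : {measure set T -> \bar R}) (rho : T -> R) :
  measurable_fun setT rho -> (forall x, 0 <= rho x) ->
  exists nu : {measure set T -> \bar R},
    (forall A, measurable A -> nu A = \int[mu]_(x in A) (rho x)%:E)%E /\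
    forall f : T -> \bar R, measurable_fun setT f -> (forall x, 0 <= f x)%E ->
      (\int[nu]_x f x = \int[mu]_x (f x * (rho x)%:E))%E.
Proof.
move=> mrho' rho0'.
have mrho : measurable_fun setT (EFin \o rho) by exact/measurable_EFinP.
have rho0 x : (0 <= (rho x)%:E)%E by rewrite lee_fin.
pose nu A := (\int[mu]_(x in A) (rho x)%:E)%E.
have nu0 : nu set0 = 0%E by rewrite /nu integral_set0.
have nu_ge0 A : (0 <= nu A)%E by apply: integral_ge0.
have nu_sa : semi_sigma_additive nu.
  move=> /= F mF tF mUF.
  rewrite /nu ge0_integral_bigcup//; last exact: measurable_funTS.
  by apply: is_cvg_ereal_nneg_natsum_cond => n _ _; apply: integral_ge0.
pose M : {measure set T -> \bar R} := HB.pack nu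
  (isMeasure.Build _ _ _ nu nu0 nu_ge0 nu_sa).
exists M; split => // f mf f0.
pose h := nnsfun_approx measurableT mf.
have -> : (\int[M]_x f x = limn (fun n => \int[M]_x (h n x)%:E))%E.
  rewrite -monotone_convergence//.
  - by apply: eq_integral => x _; apply/esym/cvg_lim => //;
      exact: cvg_nnsfun_approx.
  - by move=> n; exact/measurable_EFinP.
  - by move=> n x _; rewrite lee_fin.
  - by move=> x _ a b ab; rewrite lee_fin; exact/lefP/nd_nnsfun_approx.
have -> : (\int[mu]_x (f x * (rho x)%:E) =
    limn (fun n => \int[mu]_x ((h n x)%:E * (rho x)%:E)))%E.
  rewrite -monotone_convergence//.
  - apply: eq_integral => x _; apply/esym/cvg_lim => //.
    by apply: cvgeZr => //; exact: cvg_nnsfun_approx.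
  - by move=> n; apply: emeasurable_funM => //; exact/measurable_EFinP.
  - by move=> n x _; rewrite mule_ge0// lee_fin.
  - by move=> x _ a b ab; rewrite lee_wpmul2r// lee_fin;
      exact/lefP/nd_nnsfun_approx.
congr (limn _); apply/funext => n.
rewrite integralT_nnsfun sintegralE.
under [in RHS]eq_integral => x _.
  rewrite fimfunE -fsumEFin// ge0_mule_fsuml; last first.
    by move=> y; exact: nnfun_muleindic_ge0.
  over.
rewrite ge0_integral_fsum//; last 2 first.
  - by move=> y; apply: emeasurable_funM => //; apply/measurable_EFinP;
      exact: measurable_funM.
  - by move=> y x _; rewrite mule_ge0// nnfun_muleindic_ge0.
apply: eq_fsbigr => y; rewrite inE => -[x0 _ yE].
have y0 : 0 <= y by rewrite -yE.
under [RHS]eq_integral do rewrite EFinM -muleA.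
rewrite ge0_integralZl//; last 2 first.
  - by apply: emeasurable_funM => //; exact/measurable_EFinP.
  - by move=> x _; rewrite mule_ge0// lee_fin.
congr (_ * _)%E; rewrite /M /= /nu.
rewrite integral_mkcond; apply: eq_integral => x _.
by rewrite /patch /= indicE; case: ifPn; rewrite ?mul1e ?mul0e.
Qed.

(** * The one-dimensional normal law *)

(** Two measures on the line that agree on half-open intervals are equal. *)
Lemma lebesgue_measure_dilation (R : realType) (c : R) (A : set R) :
  0 < c -> measurable A ->
  (@lebesgue_measure R A = c%:E * @lebesgue_measure R ( *%R c @^-1` A))%E.
Proof.
move=> c0 mA.
have mc : measurable_fun [set: measurableTypeR R]
  ( *%R c : measurableTypeR R -> measurableTypeR R).
  exact: measurable_funM.
pose nu : {measure set (measurableTypeR R) -> \bar R} :=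
  mscale (NngNum (ltW c0))
    (pushforward (@lebesgue_measure R)
    ( *%R c : measurableTypeR R -> measurableTypeR R)).
have := @lebesgue_measure_unique R (nu mc) _ A mA.
apply => _ [[a b]] /= ab <-.
have pre : *%R c @^-1` `]a, b] = `]a / c, b / c]%classic.
  apply/seteqP; split => x /=; rewrite !in_itv/= ltr_pdivrMr// ler_pdivlMr//;
    by rewrite (mulrC c).
change (lebesgue_measure `]a, b] =
  c%:E * lebesgue_measure ( *%R c @^-1` `]a, b]))%E.
rewrite pre !lebesgue_measure_itv /= !lte_fin ltr_pM2r ?invr_gt0//.
case: ifPn => _; last by rewrite mule0.
by rewrite -!EFinD -EFinM -mulrBl mulrCA divff ?mulr1// gt_eqF.
Qed.

Lemma integral_dilation (R : realType) (c : R) (f : R -> \bar R) :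
  0 < c -> measurable_fun setT f -> (forall x, 0 <= f x)%E ->
  (\int[@lebesgue_measure R]_x f x =
    c%:E * \int[@lebesgue_measure R]_x f (c * x)%R)%E.
Proof.
move=> c0 mf f0.
have mc : measurable_fun [set: measurableTypeR R]
  ( *%R c : measurableTypeR R -> measurableTypeR R).
  exact: measurable_funM.
pose nu : {measure set (measurableTypeR R) -> \bar R} :=
  mscale (NngNum (ltW c0))
    (pushforward (@lebesgue_measure R)
    ( *%R c : measurableTypeR R -> measurableTypeR R)).
rewrite (@eq_measure_integral _ _ _ setT (nu mc)); last first.
  by move=> A mA _; exact: lebesgue_measure_dilation.
by rewrite ge0_integral_mscale// ge0_integral_pushforward.
Qed.

Lemma ge0_integral_normal_prob (R : realType) (m s : R) (f : R -> \bar R) :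
  measurable_fun setT f -> (forall x, 0 <= f x)%E ->
  (\int[normal_prob m s]_x f x =
   \int[@lebesgue_measure R]_x (f x * (normal_pdf m s x)%:E))%E.
Proof.
move=> mf f0.
have [nu [nuE nui]] := @density_measure R _ _ (@lebesgue_measure R)
  (normal_pdf m s)
  (measurable_normal_pdf m s) (normal_pdf_ge0 m s).
rewrite -nui//; apply: eq_measure_integral => A mA _.
by rewrite nuE.
Qed.

Lemma normal_pdf_centered_scaledE (R : realType) (m s x : R) : 0 < s ->
  normal_pdf m s x = s^-1 * normal_peak 1 * expR (- ((x - m) / s) ^+ 2 / 2).
Proof.
move=> s0; rewrite normal_pdfE ?gt_eqF//.
rewrite /normal_peak /normal_fun; congr (_ * _).
  rewrite expr1n mul1r -mulrnAr sqrtrM ?sqr_ge0// sqrtr_sqr gtr0_norm//.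
  by rewrite invfM.
congr expR; rewrite -mulr_natr; field.
by rewrite gt_eqF.
Qed.

(** Multiplying the density of N(0,1) by [exp (th * x)] gives, up to the
  constant [exp (th^2 / 2)], the density of N(th,1). *)
Lemma normal_mgf (R : realType) (th : R) :
  (\int[normal_prob 0 1]_x (expR (th * x))%:E =
    (expR (th ^+ 2 / 2))%:E :> \bar R)%E.
Proof.
rewrite ge0_integral_normal_prob; last 2 first.
- by apply/measurable_EFinP; apply: measurableT_comp => //;
    exact: measurable_funM.
- by move=> x; rewrite lee_fin expR_ge0.
under eq_integral => x _.
  rewrite -EFinM (_ : expR (th * x) * _ =
    expR (th ^+ 2 / 2) * normal_pdf th 1 x); last first.
    rewrite !normal_pdf_centered_scaledE// mulrCA [RHS]mulrCA  -!expRD;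
      congr (_ * expR _).
    by field.
  rewrite EFinM; over.
rewrite ge0_integralZl//=; last 2 first.
- by apply/measurable_EFinP; exact: measurable_normal_pdf.
- by move=> x _; rewrite lee_fin normal_pdf_ge0.
by rewrite integral_normal_pdf mule1.
Qed.

(** The same tilting argument as for [normal_mgf], with the variance instead
  of the mean: the tilted density is that of N(0, 1 / (1 - 2 l)). *)
Lemma normal_mgf_sqr (R : realType) (l : R) : l < 1 / 2 ->
  (\int[normal_prob 0 1]_x (expR (l * x ^+ 2))%:E =
    (Num.sqrt (1 - 2 * l))^-1%:E :> \bar R)%E.
Proof.
move=> l12; have k0 : 0 < 1 - 2 * l by lra.
set s := (Num.sqrt (1 - 2 * l))^-1.
have s0 : 0 < s by rewrite invr_gt0 sqrtr_gt0.
have s2 : s^-1 ^+ 2 = 1 - 2 * l by rewrite invrK sqr_sqrtr// ltW.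
rewrite ge0_integral_normal_prob; last 2 first.
- apply/measurable_EFinP; apply: measurableT_comp => //;
    apply: measurable_funM => //.
- by move=> x; rewrite lee_fin expR_ge0.
under eq_integral => x _.
  rewrite -EFinM (_ : expR (l * x ^+ 2) * _ = s * normal_pdf 0 s x); last first.
    rewrite !normal_pdf_centered_scaledE// invr1 mul1r mulrCA -!expRD !mulrA
      divff ?gt_eqF// mul1r.
    congr (_ * expR _); rewrite !subr0 ?divr1 ?invr1 ?mulr1 exprMn s2; by field.
  rewrite EFinM; over.
rewrite ge0_integralZl//=; last 3 first.
- by apply/measurable_EFinP; exact: measurable_normal_pdf.
- by move=> x _; rewrite lee_fin normal_pdf_ge0.
- by rewrite lee_fin ltW.
by rewrite integral_normal_pdf mule1.
Qed.

Lemma normal_prob_scale (R : realType) (s : R) (A : set R) :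
  0 < s -> measurable A ->
  (normal_prob 0 s A = normal_prob 0 1 ( *%R s @^-1` A) :> \bar R)%E.
Proof.
move=> s0 mA; rewrite /normal_prob integral_mkcond [RHS]integral_mkcond.
have mp t : measurable_fun setT (fun x : R => (normal_pdf 0 t x)%:E).
  by apply/measurable_EFinP; exact: measurable_normal_pdf.
rewrite (integral_dilation s0); last 2 first.
- by apply/(measurable_restrictT _ _).1 => //; exact: measurable_funTS.
- by move=> x; rewrite /patch; case: ifP => // _;
    rewrite lee_fin normal_pdf_ge0.
rewrite -ge0_integralZl//=; last 3 first.
- apply: (@measurableT_comp _ _ _ _ _ _
    ((fun x => (normal_pdf 0 s x)%:E) \_ A) _ ( *%R s)).
    by apply/(measurable_restrictT _ _).1 => //; exact: measurable_funTS.
  exact: measurable_funM.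
- by move=> x _; rewrite /patch; case: ifP => // _;
    rewrite lee_fin normal_pdf_ge0.
- by rewrite lee_fin ltW.
apply: eq_integral => x _; rewrite /patch.
rewrite (_ : (s * x \in A) = (x \in *%R s @^-1` A)); last first.
  by apply/idP/idP; rewrite !inE.
case: ifP => _; last by rewrite mule0.
rewrite -EFinM !normal_pdf_centered_scaledE//; congr EFin.
rewrite invr1 mul1r !mulrA divff ?gt_eqF// mul1r; congr (_ * expR _).
by field; rewrite gt_eqF.
Qed.

(** The tilted density belongs to N(0, 1 / k^2), which the dilation by [k]
  maps back to N(0,1). This is the one-dimensional form of
  [gaussian_dilation]. *)
Lemma normal_prob_tilt (R : realType) (k : R) (B : set R) :
  0 < k -> measurable B ->
  (\int[normal_prob 0 1]_x
    ((k * expR (- (k ^+ 2 - 1) / 2 * x ^+ 2)) * \1_B (k * x)%R)%:E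
   = normal_prob 0 1 B :> \bar R)%E.
Proof.
move=> k0 mB.
have mp t : measurable_fun setT (fun x : R => (normal_pdf 0 t x)%:E).
  by apply/measurable_EFinP; exact: measurable_normal_pdf.
have mB' : measurable_fun setT ((\1_B : R -> R) \o *%R k).
  apply: measurableT_comp; first exact: measurable_indic.
  exact: measurable_funM.
rewrite [RHS]/normal_prob [RHS]integral_mkcond (integral_dilation k0);
  last 2 first.
- by apply/(measurable_restrictT _ _).1 => //; exact: measurable_funTS.
- by move=> x; rewrite /patch; case: ifP => // _;
    rewrite lee_fin normal_pdf_ge0.
rewrite -ge0_integralZl//=; last 3 first.
- apply: (@measurableT_comp _ _ _ _ _ _
    ((fun x => (normal_pdf 0 1 x)%:E) \_ B) _ ( *%R k)).
    by apply/(measurable_restrictT _ _).1 => //; exact: measurable_funTS.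
  exact: measurable_funM.
- by move=> x _; rewrite /patch; case: ifP => // _;
    rewrite lee_fin normal_pdf_ge0.
- by rewrite lee_fin ltW.
rewrite ge0_integral_normal_prob; last 2 first.
- apply/measurable_EFinP; apply: measurable_funM => //;
    apply: measurable_funM => //.
  by apply: measurableT_comp => //; apply: measurable_funM.
- by move=> x; rewrite lee_fin !mulr_ge0 ?expR_ge0// ltW.
apply: eq_integral => x _; rewrite /patch indicE.
case: ifP => _; last by rewrite mulr0 mul0e mule0.
rewrite mulr1 -!EFinM !normal_pdf_centered_scaledE//; congr EFin.
rewrite -!mulrA; congr (_ * _); rewrite invr1 !mul1r mulrCA -!expRD;
  congr (_ * expR _).
by field.
Qed.

(** * The standard Gaussian law on tuples *)

Definition box (R : realType) (n : nat) (B : 'I_n -> set R) : set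
  (n.-tuple R) :=
  [set x | forall i, B i (tnth x i)].

(** The product formula on boxes is all that is known about the noise; it
  determines the measure because boxes are stable under intersection and
  generate the product sigma-algebra ([measurable_tupleE]). *)
Definition standard_gaussian (R : realType) (n : nat)
    (mu : {measure set (n.-tuple R) -> \bar R}) : Prop :=
  forall B : 'I_n -> set R, (forall i, measurable (B i)) ->
    (mu (box B) = \prod_(i < n) normal_prob 0 1 (B i))%E.

Lemma indic_box (R : realType) (n : nat) (B : 'I_n -> set R) (x : n.-tuple R) :
  \1_(box B) x = \prod_(i < n) \1_(B i) (tnth x i) :> R.
Proof.
rewrite indicE; have [xB|xB] := pselect (box B x).
  by rewrite mem_set// big1// => i _; rewrite indicE mem_set//; exact: xB.
have [i Bi] : exists i, ~ B i (tnth x i) by apply/existsNP.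
by rewrite memNset// (bigD1 i)//= indicE memNset// mul0r.
Qed.

Lemma measurable_box (R : realType) (n : nat) (B : 'I_n -> set R) :
  (forall i, measurable (B i)) -> measurable (box B).
Proof.
move=> mB; rewrite (_ : box B =
  \bigcap_(i in [set: 'I_n]) ((@tnth n R)^~ i @^-1` B i)).
  apply: fin_bigcap_measurable => // i _.
  by rewrite -[X in measurable X]setTI; exact: measurable_tnth.
by apply/seteqP; split => x /= h;
  [move=> i _; exact: h | move=> i; exact: (h i)].
Qed.

Lemma measurable_tnth_comp (R : realType) (n : nat) (i : 'I_n) (f : R -> R) :
  measurable_fun setT f ->
    measurable_fun setT (fun x : n.-tuple R => f (tnth x i)).
Proof. by move=> mf; apply: (measurableT_comp mf); exact: measurable_tnth. Qed.

Lemma integral_normal_indic (R : realType) (B : set R) : measurable B ->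
  (\int[normal_prob 0 1]_x (\1_B x : R)%:E = normal_prob 0 1 B)%E.
Proof.
by move=> mB; rewrite integral_indic//; congr (normal_prob _ _ _); exact: setIT.
Qed.

(** Independence for functions instead of sets. The indicators of the product
  formula are replaced by general functions one coordinate at a time: with the
  other factors as a density, the image measure under the coordinate [j] is a
  multiple of N(0,1). *)
Lemma integral_prod_tnth (R : realType) (n : nat)
    (mu : {measure set (n.-tuple R) -> \bar R}) (f : 'I_n -> R -> R)
      (c : 'I_n -> R) :
  standard_gaussian mu ->
  (forall i, measurable_fun setT (f i)) -> (forall i x, 0 <= f i x) ->
  (forall i, \int[normal_prob 0 1]_x (f i x)%:E = (c i)%:E)%E ->
  (\int[mu]_x (\prod_(i < n) f i (tnth x i))%:E = (\prod_(i < n) c i)%:E)%E.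
Proof.
move=> gmu.
suff H k : (k <= n)%N -> forall (f : 'I_n -> R -> R) (c : 'I_n -> R),
    (forall i : 'I_n, (k <= i)%N -> exists2 B, measurable B & f i = \1_B) ->
    (forall i, measurable_fun setT (f i)) -> (forall i x, 0 <= f i x) ->
    (forall i, \int[normal_prob 0 1]_x (f i x)%:E = (c i)%:E)%E ->
    (\int[mu]_x (\prod_(i < n) f i (tnth x i))%:E = (\prod_(i < n) c i)%:E)%E.
  by apply: (H n) => // i; rewrite leqNgt ltn_ord.
elim: k => [_|k IH kn] {}f {}c fB mf f0 fc.
  have /(_ _)/cid2 Bs i := fB i (leq0n i).
  pose B i := s2val (Bs i).
  have mB i : measurable (B i) by exact: (s2valP (Bs i)).
  have fE i : f i = \1_(B i) by exact: (s2valP' (Bs i)).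
  have cE i : (c i)%:E = normal_prob 0 1 (B i).
    by rewrite -fc fE integral_normal_indic.
  under eq_integral => x _.
    under eq_bigr do rewrite fE. rewrite -indic_box. over.
  rewrite integral_indic ?setIT//; last exact: measurable_box.
  rewrite gmu// (big_morph EFin (@EFinM _) (erefl _)).
  by apply: eq_bigr => i _; rewrite cE.
pose j := Ordinal kn.
have c0 i : 0 <= c i.
  by rewrite -lee_fin -fc; apply: integral_ge0 => x _; rewrite lee_fin.
pose C := \prod_(i < n | i != j) c i.
have C0 : 0 <= C by rewrite prodr_ge0.
pose rho (x : n.-tuple R) := \prod_(i < n | i != j) f i (tnth x i).
have rho0 x : 0 <= rho x by rewrite prodr_ge0.
have mrho : measurable_fun setT rho.
  rewrite /rho; under eq_fun do rewrite -big_filter.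
  by apply: measurable_prod => i _; exact: measurable_tnth_comp.
have [nu [nuE nui]] := density_measure mu mrho rho0.
have mj : measurable_fun setT
  (fun x : n.-tuple R => tnth x j) by exact: measurable_tnth.
have pushE (B : set R) : measurable B ->
    (pushforward nu (fun x : n.-tuple R => tnth x j) B =
      C%:E * normal_prob 0 1 B)%E.
  move=> mB; rewrite /pushforward nuE; last first.
    by rewrite -[X in measurable X]setTI; exact: mj.
  pose f' i := if i == j then \1_B else f i.
  pose c' i := if i == j then fine (normal_prob 0 1 B) else c i.
  have cB : (fine (normal_prob (0 : R) 1 B))%:E = normal_prob 0 1 B.
    by rewrite fineK// fin_num_measure.
  have -> : (C%:E * normal_prob 0 1 B = (\prod_(i < n) c' i)%:E)%E.
    rewrite (bigD1 j)//= {1}/c' eqxx mulrC EFinM cB; congr (_%:E * _)%E.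
    by apply: eq_bigr => i ij; rewrite /c' (negbTE ij).
  rewrite -(IH (ltnW kn) f' c').
  - rewrite integral_mkcond; apply: eq_integral => x _.
    rewrite (bigD1 j)//= {1}/f' eqxx /patch indicE.
    rewrite (_ : (x \in _) = (tnth x j \in B)); last by apply/idP/idP;
      rewrite !inE.
    case: ifP => _; last by rewrite mul0r.
    rewrite mul1r; congr EFin; apply: eq_bigr => i ij.
    by rewrite /f' (negbTE ij).
  - move=> i ki; rewrite /f'; case: eqVneq => [_|ij]; first by exists B.
    apply: fB; rewrite ltn_neqAle ki andbT; apply: contra ij => /eqP kiE.
    by apply/eqP/val_inj.
  - by move=> i; rewrite /f'; case: ifP => // _; exact: measurable_indic.
  - by move=> i x; rewrite /f'; case: ifP.
  - move=> i; rewrite /f' /c'; case: ifP => // _.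
    by rewrite integral_normal_indic// cB.
under eq_integral => x _ do rewrite (bigD1 j)//= EFinM.
rewrite -(nui (fun x => (f j (tnth x j))%:E)); last 2 first.
- by apply/measurable_EFinP; exact: measurable_tnth_comp.
- by move=> x; rewrite lee_fin.
pose pj : {measure set (measurableTypeR R) -> \bar R} :=
  pushforward nu (fun x : n.-tuple R => tnth x j : measurableTypeR R).
have mfj : measurable_fun [set: measurableTypeR R] (EFin \o f j).
  by apply/measurable_EFinP; exact: mf.
transitivity (\int[pj mj]_x (f j x)%:E)%E.
  apply/esym; etransitivity.
    apply: (@ge0_integral_pushforward _ _ _ (measurableTypeR R) _ _ mj nu setT
      (EFin \o f j)) => //.
    by move=> y _; rewrite lee_fin.
  by rewrite preimage_setT.
transitivity (\int[mscale (NngNum C0) (normal_prob 0 1)]_x (f j x)%:E)%E.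
  by apply: eq_measure_integral => A mA _; exact: pushE.
rewrite ge0_integral_mscale//; last by move=> x _; rewrite lee_fin.
by rewrite (fc j) /= (bigD1 j)//= mulrC EFinM.
Qed.

Lemma measurable_tupleE (R : realType) (n : nat) :
  @measurable _ (n.-tuple R) =
  <<s [set A | exists2 B : 'I_n -> set R, (forall i, measurable (B i)) & A =
    box B] >>.
Proof.
apply/seteqP; split.
  apply: smallest_sub; first exact: smallest_sigma_algebra.
  move=> A; rewrite -bigcup_seq => -[i /= _ [B mB <-]]; rewrite setTI.
  apply: sub_sigma_algebra; exists (fun j => if j == i then B else setT).
    by move=> j; case: ifP.
  apply/seteqP; split => x /=; first by move=> xB j; case: eqVneq => [->|].
  by move=> /(_ i); rewrite eqxx.
apply: smallest_sub; first exact: sigma_algebra_measurable.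
by move=> _ [B mB ->]; exact: measurable_box.
Qed.

Lemma standard_gaussian_setT (R : realType) (n : nat)
    (mu : {measure set (n.-tuple R) -> \bar R}) :
  standard_gaussian mu -> mu setT = 1%E.
Proof.
move=> gmu; rewrite (_ : setT = box (fun=> setT)); last first.
  by apply/seteqP; split.
by rewrite gmu// big1// => i _; exact: probability_setT.
Qed.

Lemma gaussian_mgf (R : realType) (n : nat)
    (mu : {measure set (n.-tuple R) -> \bar R}) (v : 'I_n -> R) :
  standard_gaussian mu ->
  (\int[mu]_x (expR (\sum_(i < n) v i * tnth x i))%:E =
   (expR ((\sum_(i < n) v i ^+ 2) / 2))%:E)%E.
Proof.
move=> gmu.
under eq_integral do rewrite expR_sum.
rewrite (@integral_prod_tnth _ _ _ (fun i x => expR (v i * x))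
  (fun i => expR (v i ^+ 2 / 2)))//.
- by rewrite mulr_suml expR_sum.
- by move=> i; apply: measurableT_comp => //; exact: measurable_funM.
- by move=> i; exact: normal_mgf.
Qed.

Definition dilate (R : realType) (n : nat) (k : R)
  (x : n.-tuple R) : n.-tuple R :=
  [tuple k * tnth x i | i < n].

Lemma measurable_dilate (R : realType) (n : nat) (k : R) :
  measurable_fun setT (@dilate R n k).
Proof.
apply/measurable_fun_tnthP => i.
rewrite (_ : _ \o _ = fun x : n.-tuple R => k * tnth x i).
  by apply: measurable_funM => //; exact: measurable_tnth.
by apply/funext => x /=; rewrite tnth_mktuple.
Qed.

(** For [H] constant on rays, weighting by [k^n * exp (- (k^2 - 1) / 2 *
  |x|^2)] does not change the integral, since it amounts to the dilation by
  [k]. This expresses that [|x|] is independent of the direction of [x]. *)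
Lemma gaussian_dilation (R : realType) (n : nat)
    (mu : {measure set (n.-tuple R) -> \bar R}) (k : R) (H : n.-tuple R -> R) :
  standard_gaussian mu -> 0 < k ->
  measurable_fun setT H -> (forall x, 0 <= H x) ->
  (forall x, H (dilate k x) = H x) ->
  (\int[mu]_x (H x * (k ^+ n *
      expR (- (k ^+ 2 - 1) / 2 * \sum_(i < n) tnth x i ^+ 2)))%:E =
   \int[mu]_x (H x)%:E)%E.
Proof.
move=> gmu k0 mH H0 Hk.
pose r (y : R) := k * expR (- (k ^+ 2 - 1) / 2 * y ^+ 2).
have mr : measurable_fun setT r.
  by apply: measurable_funM => //; apply: measurableT_comp => //;
    exact: measurable_funM.
have r0 y : 0 <= r y by rewrite mulr_ge0 ?expR_ge0// ltW.
pose rho (x : n.-tuple R) := \prod_(i < n) r (tnth x i).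
have rhoE x : rho x = k ^+ n * expR
  (- (k ^+ 2 - 1) / 2 * \sum_(i < n) tnth x i ^+ 2).
  by rewrite mulr_sumr expR_sum /rho big_split/= prodr_const card_ord.
have rho0 x : 0 <= rho x by rewrite prodr_ge0.
have mrho : measurable_fun setT rho.
  by apply: measurable_prod => i _; exact: measurable_tnth_comp.
have [nu [nuE nui]] := density_measure mu mrho rho0.
pose pd : {measure set (n.-tuple R) -> \bar R} :=
  pushforward nu (@dilate R n k).
have mk := @measurable_dilate R n k.
have mupd A : measurable A -> mu A = pd mk A.
  apply: (measure_unique _ (fun=> setT) (@measurable_tupleE R n)) => //.
  - move=> _ _ [B mB ->] [B' mB' ->]; exists (fun i => B i `&` B' i).
      by move=> i; exact: measurableI.
    by apply/seteqP; split => x /=;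
      [case=> h h' i; split | move=> h; split => i; case: (h i)].
  - by move=> _; exists (fun=> setT) => //; apply/seteqP; split.
  - by rewrite bigcup_const.
  - move=> _ [B mB ->].
    have -> : pd mk (box B) =
      (\int[mu]_x (\prod_(i < n)
      (r (tnth x i) * \1_(B i) (k * tnth x i)))%:E)%E.
      rewrite /pd /= /pushforward nuE; last first.
        by rewrite -[X in measurable X]setTI; apply: mk => //;
          exact: measurable_box.
      rewrite integral_mkcond; apply: eq_integral => x _.
      rewrite big_split/= -/(rho x).
      have -> : \prod_(i < n) \1_(B i) (k * tnth x i) =
        \1_(box B) (dilate k x) :> R.
        by rewrite indic_box; apply: eq_bigr => i _; rewrite tnth_mktuple.
      rewrite /patch indicE.
      rewrite (_ : (x \in _) = (dilate k x \in box B)); last by apply/idP/idP;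
        rewrite !inE.
      by case: ifP => _; rewrite ?mulr1 ?mulr0.
    rewrite gmu//.
    pose c i := fine (normal_prob (0 : R) 1 (B i)).
    have cE i : (c i)%:E = normal_prob 0 1 (B i) by rewrite fineK//;
      apply: fin_num_measure; exact: mB.
    rewrite (@integral_prod_tnth _ _ _ (fun i y => r y * \1_(B i) (k * y)) c)//.
    + rewrite (big_morph EFin (@EFinM _) (erefl _)).
      by apply: eq_bigr => i _; rewrite cE.
    + move=> i; apply: measurable_funM => //.
      rewrite (_ : (fun _ => _) = (\1_(B i) : R -> R) \o *%R k)//.
      by apply: measurableT_comp;
        [exact: measurable_indic | exact: measurable_funM].
    + by move=> i y; rewrite mulr_ge0.
    + by move=> i; rewrite cE; exact: normal_prob_tilt.
  - by move=> _; rewrite standard_gaussian_setT// ltry.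
have mEH : measurable_fun setT (EFin \o H) by exact/measurable_EFinP.
under eq_integral => x _ do rewrite -rhoE EFinM.
rewrite -(nui (EFin \o H))//.
transitivity (\int[pd mk]_x (H x)%:E)%E.
  apply/esym; etransitivity.
    apply: (@ge0_integral_pushforward _ _ _ _ _ _ mk nu setT (EFin \o H)) => //.
    by move=> y _; rewrite lee_fin.
  rewrite preimage_setT; apply: eq_integral => x _ /=.
  by rewrite Hk.
by apply: eq_measure_integral => A mA _; rewrite mupd.
Qed.

(** * Inner products and orthogonal projectors *)

Definition dotp (R : realType) (n : nat) (u v : 'cV[R]_n) : R :=
  \sum_(i < n) u i 0 * v i 0.

Definition vec (R : realType) (n : nat) (x : n.-tuple R) : 'cV[R]_n :=
  \col_i tnth x i.

Lemma dotpE (R : realType) (n : nat) (u v : 'cV[R]_n) :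
  dotp u v = (u^T *m v) 0 0.
Proof. by rewrite mxE; apply: eq_bigr => i _; rewrite mxE. Qed.

Lemma dotpC (R : realType) (n : nat) (u v : 'cV[R]_n) : dotp u v = dotp v u.
Proof. by apply: eq_bigr => i _; rewrite mulrC. Qed.

Lemma dotpDl (R : realType) (n : nat) (u v w : 'cV[R]_n) :
  dotp (u + v) w = dotp u w + dotp v w.
Proof. by rewrite -big_split; apply: eq_bigr => i _; rewrite !mxE mulrDl. Qed.

Lemma dotpZl (R : realType) (n : nat) (c : R) (u w : 'cV[R]_n) :
  dotp (c *: u) w = c * dotp u w.
Proof. by rewrite mulr_sumr; apply: eq_bigr => i _; rewrite !mxE mulrA. Qed.

Lemma dotpDr (R : realType) (n : nat) (u v w : 'cV[R]_n) :
  dotp w (u + v) = dotp w u + dotp w v.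
Proof. by rewrite dotpC dotpDl !(dotpC w). Qed.

Lemma dotpZr (R : realType) (n : nat) (c : R) (u w : 'cV[R]_n) :
  dotp w (c *: u) = c * dotp w u.
Proof. by rewrite dotpC dotpZl (dotpC w). Qed.

Lemma dotpNl (R : realType) (n : nat) (u w : 'cV[R]_n) :
  dotp (- u) w = - dotp u w.
Proof. by rewrite -scaleN1r dotpZl mulN1r. Qed.

Lemma dotpNr (R : realType) (n : nat) (u w : 'cV[R]_n) :
  dotp w (- u) = - dotp w u.
Proof. by rewrite dotpC dotpNl dotpC. Qed.

Lemma dotp_ge0 (R : realType) (n : nat) (u : 'cV[R]_n) : 0 <= dotp u u.
Proof. by apply: sumr_ge0 => i _; rewrite -expr2 sqr_ge0. Qed.

Lemma dotp_eq0 (R : realType) (n : nat) (u : 'cV[R]_n) :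
  (dotp u u == 0) = (u == 0).
Proof.
apply/eqP/eqP => [|->]; last by rewrite /dotp big1// => i _; rewrite mxE mul0r.
move=> /eqP; rewrite psumr_eq0; last by move=> i _; rewrite -expr2 sqr_ge0.
move=> /allP h; apply/colP => i; rewrite [RHS]mxE.
by have := h i (mem_index_enum i); rewrite /= mulf_eq0 orbb => /eqP.
Qed.

Lemma dotp_mulmx (R : realType) (m n : nat) (A : 'M[R]_(m, n)) (u : 'cV[R]_m)
  (v : 'cV[R]_n) :
  dotp u (A *m v) = dotp (A^T *m u) v.
Proof. by rewrite !dotpE trmx_mul trmxK mulmxA. Qed.

Lemma dotp_projE (R : realType) (n : nat) (P : 'M[R]_n) (x : 'cV[R]_n) :
  P^T = P -> P *m P = P -> dotp (P *m x) (P *m x) = dotp x (P *m x).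
Proof. by move=> sP iP; rewrite dotp_mulmx sP mulmxA iP dotpC. Qed.

(** Peeling off one line of the range lowers the rank and splits the squared
  norm; by induction on the rank this replaces the choice of an orthonormal
  basis of the range. *)
Lemma projector_remove_line (R : realType) (n : nat) (P : 'M[R]_n) :
  P^T = P -> P *m P = P -> P != 0 ->
  exists b : 'cV[R]_n, let Q := P - b *m b^T in
    [/\ dotp b b = 1, P *m b = b, Q^T = Q, Q *m Q = Q &
    (\rank Q < \rank P)%N /\ forall x, dotp (P *m x) (P *m x) =
       dotp (Q *m x) (Q *m x) + dotp b x ^+ 2].
Proof.
move=> sP iP P0.
have [j uj0] : exists j, col j P != 0.
  apply/existsP; apply: contraR P0 => /existsPn h; apply/eqP/matrixP => i j.
  by have /negPn/eqP/colP/(_ i) := h j; rewrite !mxE.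
set u := col j P in uj0.
have Pu : P *m u = u by rewrite /u colE mulmxA iP.
have du : 0 < dotp u u by rewrite lt_def dotp_ge0 dotp_eq0 uj0.
pose b := (Num.sqrt (dotp u u))^-1 *: u.
have bb : dotp b b = 1.
  rewrite dotpZl dotpZr mulrA -expr2 exprVn sqr_sqrtr ?ltW// mulVf// gt_eqF//.
have Pb : P *m b = b by rewrite /b -scalemxAr Pu.
have bP : b^T *m P = b^T by rewrite -[in LHS]sP -trmx_mul Pb.
have bbE : b^T *m b = 1%:M.
  by apply/matrixP => i k; rewrite !ord1 -dotpE bb mxE.
exists b => Q.
have sQ : Q^T = Q by rewrite /Q linearB/= sP trmx_mul trmxK.
have iQ : Q *m Q = Q.
  rewrite /Q mulmxBl !mulmxBr iP mulmxA Pb -(mulmxA b) bP.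
  by rewrite mulmxA -(mulmxA b) bbE mulmx1 subrr subr0.
have QP : Q *m P = Q by rewrite /Q mulmxBl iP -mulmxA bP.
have Qb : Q *m b = 0 by rewrite /Q mulmxBl Pb -mulmxA bbE mulmx1 subrr.
split => //; split.
  apply: rank_ltmx; rewrite /ltmx -{1}QP submxMl /=.
  apply/negP => /submxP[M PE]; move: bb;
    rewrite dotpE -bP PE -!mulmxA Qb !mulmx0 mxE.
  by move/esym/eqP; rewrite oner_eq0.
move=> x; rewrite !dotp_projE// /Q mulmxBl dotpDr dotpNr -addrA
  [X in _ + X](_ : _ = 0) ?addr0//.
rewrite -mulmxA (_ : b^T *m x = (dotp b x)%:M); last first.
  by apply/matrixP => i k; rewrite !ord1 -dotpE mxE.
by rewrite mul_mx_scalar dotpZr (dotpC x) expr2 addNr.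
Qed.

Lemma dotp0l (R : realType) (n : nat) (u : 'cV[R]_n) : dotp 0 u = 0.
Proof. by rewrite /dotp big1// => i _; rewrite mxE mul0r. Qed.

Lemma dotp0r (R : realType) (n : nat) (u : 'cV[R]_n) : dotp u 0 = 0.
Proof. by rewrite dotpC dotp0l. Qed.

Lemma dotp_cauchy_schwarz (R : realType) (n : nat) (u v : 'cV[R]_n) :
  dotp u v ^+ 2 <= dotp u u * dotp v v.
Proof.
have := dotp_ge0 v; rewrite le_eqVlt => /predU1P[v0|v0].
  have /eqP -> : v == 0 by rewrite -dotp_eq0 -v0.
  by rewrite !dotp0r expr0n mulr0.
have := dotp_ge0 (dotp v v *: u - dotp u v *: v).
rewrite !dotpDl !dotpDr !dotpNl !dotpNr !dotpZl !dotpZr (dotpC v u).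
set a := dotp u u; set b := dotp u v; rewrite -/b in v0 *.
set c := dotp v v in v0 *.
have -> : c * (c * a) - c * (b * b) + (- (b * (c * b)) - - (b * (b * c))) =
  c * (c * a - b ^+ 2).
  by ring.
by rewrite pmulr_rge0// subr_ge0 mulrC.
Qed.

Lemma dotp_le_sqrt (R : realType) (n : nat) (u v : 'cV[R]_n) :
  `|dotp u v| <= Num.sqrt (dotp u u) * Num.sqrt (dotp v v).
Proof.
by rewrite -sqrtr_sqr -sqrtrM ?dotp_ge0// ler_wsqrtr// dotp_cauchy_schwarz.
Qed.

(** * Gaussian quadratic forms *)

Lemma measurable_dotp (R : realType) (n : nat) (v : 'cV[R]_n) :
  measurable_fun setT (fun x : n.-tuple R => dotp v (vec x)).
Proof.
apply: measurable_sum => i; apply: measurable_funM => //.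
under eq_fun do rewrite mxE.
exact: measurable_tnth.
Qed.

Lemma measurable_sqnorm (R : realType) (m n : nat) (A : 'M[R]_(m, n)) :
  measurable_fun setT (fun x : n.-tuple R => dotp (A *m vec x) (A *m vec x)).
Proof.
apply: measurable_sum => i.
have mA : measurable_fun setT (fun x : n.-tuple R => (A *m vec x) i 0).
  rewrite (_ : (fun _ => _) = fun x : n.-tuple R => dotp (row i A)^T (vec x)).
    exact: measurable_dotp.
  by apply/funext => x; rewrite dotpE trmxK -row_mul [RHS]mxE.
exact: measurable_funM.
Qed.

Definition sqn (R : realType) (n : nat) (x : n.-tuple R) : R :=
  dotp (vec x) (vec x).

Lemma sqn_ge0 (R : realType) (n : nat) (x : n.-tuple R) : 0 <= sqn x.
Proof. exact: dotp_ge0. Qed.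

Lemma measurable_sqn (R : realType) (n : nat) :
  measurable_fun setT (@sqn R n).
Proof.
rewrite (_ : @sqn R n = fun x => dotp (1%:M *m vec x) (1%:M *m vec x)).
  exact: measurable_sqnorm.
by apply/funext => x; rewrite !mul1mx.
Qed.

Lemma gaussian_dotp_mgf (R : realType) (n : nat)
    (mu : {measure set (n.-tuple R) -> \bar R}) (v : 'cV[R]_n) :
  standard_gaussian mu ->
  (\int[mu]_x (expR (dotp v (vec x)))%:E = (expR (dotp v v / 2))%:E)%E.
Proof.
move=> gmu; rewrite -(@gaussian_mgf _ _ _ (fun i => v i 0) gmu).
by apply: eq_integral => x _; congr (expR _)%:E; apply: eq_bigr => i _;
  rewrite mxE.
Qed.

(** Laplace transform of a chi-square variable with at most [r] degrees of
  freedom. The identity behind the induction on [r] is that [exp (l <b, x>^2)]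
  is the average of [exp (sqrt (2 l) g <b, x>)] over a further normal variable
  [g]: exchanging the integrals reduces the rank by one and shifts the linear
  term [v] along [b]. This is why the linear term is part of the statement. *)
Lemma gaussian_projection_mgf (R : realType) (n : nat)
    (mu : probability (n.-tuple R) R) (l : R) (r : nat) (P : 'M[R]_n)
      (v : 'cV[R]_n) :
  standard_gaussian mu -> 0 <= l -> l < 1 / 2 ->
  P^T = P -> P *m P = P -> (\rank P <= r)%N -> P *m v = 0 ->
  (\int[mu]_x (expR (l * dotp (P *m vec x) (P *m vec x) + dotp v (vec x)))%:E
   <= ((Num.sqrt (1 - 2 * l))^-1 ^+ r * expR (dotp v v / 2))%:E)%E.
Proof.
move=> gmu l0 l12.
set C := (Num.sqrt (1 - 2 * l))^-1.
have C1 : 1 <= C.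
  rewrite -[leLHS]invr1 lef_pV2 ?posrE ?sqrtr_gt0//; last lra.
  by rewrite -[leRHS]sqrtr1 ler_wsqrtr//; lra.
elim: r P v => [|r IH] P v sP iP rP Pv.
  have -> : P = 0 by apply/eqP; rewrite -mxrank_eq0 -leqn0.
  under eq_integral => x _.
    rewrite mul0mx [dotp 0 0]big1; last by move=> i _; rewrite mxE mul0r.
    rewrite mulr0 add0r; over.
  by rewrite expr0 mul1r gaussian_dotp_mgf.
have [P0|P0] := eqVneq P 0.
  apply: le_trans (IH P v sP iP _ Pv) _; first by rewrite P0 mxrank0.
  rewrite lee_fin ler_wpM2r ?expR_ge0// exprS ler_peMl ?exprn_ge0//.
  exact: le_trans C1.
have [b] := projector_remove_line sP iP P0.
set Q := P - _ => -[bb Pb sQ iQ [rQ PQ]].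
have rQr : (\rank Q <= r)%N by rewrite -ltnS (leq_trans rQ).
have bv : dotp b v = 0.
  by rewrite -Pb dotpC dotp_mulmx sP Pv /dotp big1// => i _; rewrite mxE mul0r.
have Qb : Q *m b = 0.
  rewrite /Q mulmxBl Pb -mulmxA (_ : b^T *m b = 1%:M) ?mulmx1 ?subrr//.
  by apply/matrixP => i k; rewrite !ord1 -dotpE bb mxE.
have Qv : Q *m v = 0.
  rewrite /Q mulmxBl Pv -mulmxA (_ : b^T *m v = 0) ?mulmx0 ?subrr//.
  by apply/matrixP => i k; rewrite !ord1 -dotpE bv mxE.
pose s := Num.sqrt (2 * l).
have s2 : s ^+ 2 = 2 * l by rewrite sqr_sqrtr// mulr_ge0.
pose G (x : n.-tuple R) (g : R) :=
  expR (l * dotp (Q *m vec x) (Q *m vec x) + dotp v (vec x)) * expR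
    (s * g * dotp b (vec x)).
have GE x g : G x g = expR (l * dotp (Q *m vec x) (Q *m vec x) +
                            dotp (v + (s * g) *: b) (vec x)).
  by rewrite /G -expRD dotpDl dotpZl addrA.
have m1 : measurable_fun setT
  (fun x : n.-tuple R => expR
  (l * dotp (Q *m vec x) (Q *m vec x) + dotp v (vec x))).
  apply: measurableT_comp => //; apply: measurable_funD;
    last exact: measurable_dotp.
  by apply: measurable_funM => //; exact: measurable_sqnorm.
have mG : measurable_fun setT
  (fun z : n.-tuple R * measurableTypeR R => (G z.1 z.2)%:E).
  apply/measurable_EFinP; apply: measurable_funM.
    by apply: (measurableT_comp m1); exact: measurable_fst.
  apply: measurableT_comp => //; apply: measurable_funM.
    by apply: measurable_funM => //; exact: measurable_snd.
  by apply: (measurableT_comp (measurable_dotp b)); exact: measurable_fst.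
have -> : (\int[mu]_x (expR
  (l * dotp (P *m vec x) (P *m vec x) + dotp v (vec x)))%:E
  = \int[mu]_x \int[normal_prob 0 1]_g (G x g)%:E)%E.
  apply: eq_integral => x _.
  rewrite /G; under [RHS]eq_integral do rewrite EFinM.
  rewrite ge0_integralZl//; last first.
    apply/measurable_EFinP; apply: measurableT_comp => //;
      apply: measurable_funM => //.
  under eq_integral do rewrite mulrAC.
  rewrite normal_mgf -EFinM -expRD; congr (expR _)%:E.
  by rewrite PQ exprMn s2; field.
rewrite (@fubini_tonelli _ _ _ (measurableTypeR R) R mu (normal_prob 0 1)
  (fun z => (G z.1 z.2)%:E))//=; last first.
  by move=> z; rewrite lee_fin mulr_ge0 ?expR_ge0.
apply: (@le_trans _ _ (\int[normal_prob 0 1]_g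
  ((C ^+ r * expR (dotp v v / 2))%:E * (expR (l * g ^+ 2))%:E)))%E.
  apply: ge0_le_integral => //.
  - by move=> g _; apply: integral_ge0 => x _;
      rewrite lee_fin mulr_ge0 ?expR_ge0.
  - apply: (@measurable_fun_fubini_tonelli_G _ _ _ _ _ mu
      (fun z : n.-tuple R * measurableTypeR R => (G z.1 z.2)%:E)) => //.
    by move=> z; rewrite lee_fin mulr_ge0 ?expR_ge0.
  - by apply: emeasurable_funM => //; apply/measurable_EFinP;
      apply: measurableT_comp => //; apply: measurable_funM.
  - move=> g _; under eq_integral do rewrite GE.
    apply: le_trans (IH Q (v + (s * g) *: b) sQ iQ rQr _) _.
      by rewrite mulmxDr Qv -scalemxAr Qb scaler0 addr0.
    rewrite -EFinM lee_fin -mulrA ler_wpM2l ?exprn_ge0 ?(le_trans _ C1)//.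
    rewrite -expRD ler_expR dotpDl !dotpDr !dotpZl !dotpZr bb bv (dotpC v) bv.
    rewrite !mulr0 addr0 add0r mulr1 mulrACA -!expr2 s2.
    rewrite le_eqVlt; apply/orP; left; apply/eqP; by field.
rewrite ge0_integralZl//; last 2 first.
- by apply/measurable_EFinP; apply: measurableT_comp => //;
    apply: measurable_funM.
- by rewrite lee_fin mulr_ge0 ?expR_ge0 ?exprn_ge0 ?(le_trans _ C1).
by rewrite normal_mgf_sqr// -EFinM lee_fin -/C exprSr mulrAC.
Qed.

Lemma markov_bound (R : realType) (d : measure_display) (T : measurableType d)
    (mu : {measure set T -> \bar R}) (f : T -> R) (c M : R) (A : set T) :
  measurable_fun setT f -> (forall x, 0 <= f x) -> 0 < c ->
  (\int[mu]_x (f x)%:E <= M%:E)%E -> measurable A ->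
    (forall x, A x -> c <= f x) ->
  (mu A <= (M / c)%:E)%E.
Proof.
move=> mf f0 c0 fM mA Af.
have mEf : measurable_fun setT (EFin \o f) by exact/measurable_EFinP.
rewrite EFinM lee_pdivlMr// muleC.
apply: le_trans fM.
rewrite -integral_cst//.
apply: (@le_trans _ _ (\int[mu]_(x in A) (f x)%:E)%E).
  apply: ge0_le_integral => //.
  - by move=> x _; rewrite lee_fin ltW.
  - exact: measurable_funTS.
by apply: ge0_subset_integral => // x _; rewrite lee_fin.
Qed.

Lemma measurable_lt_set (R : realType) (d : measure_display)
    (T : measurableType d) (f : T -> R) (c : R) :
  measurable_fun setT f -> measurable [set x | f x < c].
Proof.
move=> mf; rewrite (_ : [set _ | _] = f @^-1` `]-oo, c[%classic).
  by rewrite -[X in measurable X]setTI; apply: mf => //; exact: measurable_itv.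
by apply/seteqP; split => x /=; rewrite in_itv.
Qed.

Lemma measurable_gt_set (R : realType) (d : measure_display)
    (T : measurableType d) (f : T -> R) (c : R) :
  measurable_fun setT f -> measurable [set x | c < f x].
Proof.
move=> mf; rewrite (_ : [set _ | _] = f @^-1` `]c, +oo[%classic).
  by rewrite -[X in measurable X]setTI; apply: mf => //; exact: measurable_itv.
by apply/seteqP; split => x /=; rewrite in_itv/= andbT.
Qed.

Section tails.
Context (R : realType) (n : nat) (mu : probability (n.-tuple R) R)
  (gmu : standard_gaussian mu).

Lemma sum_sqr_tnth (x : n.-tuple R) : \sum_(i < n) tnth x i ^+ 2 = sqn x.
Proof. by apply: eq_bigr => i _; rewrite !mxE expr2. Qed.

(** Chernoff bound for [exp (- l * |x|^2)], whose expectation comes from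
  [gaussian_dilation] with a constant function. *)
Lemma chi2_lower_tail (a : R) : 0 < a -> (0 < n)%N ->
  (mu [set x | (sqn x < n%:R - Num.sqrt (8 * a * n%:R))%R] <=
    (expR (- a))%:E)%E.
Proof.
move=> a0 n0; set q := Num.sqrt _.
have nR : (0 : R) < n%:R by rewrite ltr0n.
have q0 : 0 < q by rewrite sqrtr_gt0 !mulr_gt0.
have q2 : q ^+ 2 = 8 * a * n%:R by rewrite sqr_sqrtr// !mulr_ge0// ltW.
(* Once 1 + 2 l is bounded below by exp (2 l - 4 l^2), the Chernoff exponent is
  2 n l^2 - l q, which this l minimises. *)
pose l := q / (4 * n%:R).
have l0 : 0 < l by rewrite divr_gt0// mulr_gt0.
pose k := Num.sqrt (1 + 2 * l).
have k0 : 0 < k by rewrite sqrtr_gt0; lra.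
have k2 : k ^+ 2 = 1 + 2 * l by rewrite sqr_sqrtr//; lra.
have kn0 : 0 < k ^+ n by rewrite exprn_gt0.
have mf : measurable_fun setT
  (fun x : n.-tuple R => k ^+ n * expR (- l * sqn x)).
  by apply: measurable_funM => //; apply: measurableT_comp => //;
    apply: measurable_funM => //; exact: measurable_sqn.
have Ef : (\int[mu]_x (k ^+ n * expR (- l * sqn x))%:E = 1)%E.
  have := @gaussian_dilation R n mu k (cst 1) gmu k0 (measurable_cst _)
    (fun=> ler01) (fun=> erefl).
  have -> : (\int[mu]_x (cst (1 : R) x)%:E = 1)%E.
    by rewrite (integral_cst _ measurableT (1 : R)%:E) mul1e;
      exact: probability_setT.
  move=> <-.
  apply: eq_integral => x _; rewrite sum_sqr_tnth mul1r.
  rewrite (_ : - (k ^+ 2 - 1) / 2 = - l)//.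
  by rewrite k2; lra.
have := @markov_bound R _ _ mu _ (k ^+ n * expR (- l * (n%:R - q))) 1
  [set x | sqn x < n%:R - q] mf.
move=> /(_ _ _ _ _ _)/le_trans; apply.
- by move=> x; rewrite mulr_ge0 ?expR_ge0 ?ltW.
- by rewrite mulr_gt0 ?expR_gt0.
- by rewrite Ef.
- apply: measurable_lt_set; exact: measurable_sqn.
- move=> x /= xq; rewrite ler_wpM2l ?(ltW kn0)// ler_expR !mulNr lerN2 ler_wpM2l
    ?ltW//.
rewrite lee_fin div1r invfM.
(* For x = 2 l this is exp (x - x^2) <= 1 / (1 - x + x^2) <= 1 + x. *)
have ek : expR (2 * l - 4 * l ^+ 2) <= k ^+ 2.
  rewrite k2 -[expR _]invrK -expRN.
  have h : 1 - 2 * l + 4 * l ^+ 2 <= expR (- (2 * l - 4 * l ^+ 2)).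
    by have := expR_ge1Dx (- (2 * l - 4 * l ^+ 2)); lra.
  have h0 : 0 < 1 - 2 * l + 4 * l ^+ 2 by nra.
  apply: (@le_trans _ _ (1 - 2 * l + 4 * l ^+ 2)^-1).
    by rewrite lef_pV2 ?posrE ?expR_gt0.
  rewrite -div1r ler_pdivrMr//; have : 0 < l ^+ 3 by rewrite exprn_gt0.
  rewrite !exprS expr0; nra.
have ek1 : expR (l - 2 * l ^+ 2) <= k.
  rewrite -(@ler_pXn2r _ 2) ?nnegrE ?expR_ge0 ?(ltW k0)// -expRM_natr.
  by rewrite (_ : _ * 2%:R = 2 * l - 4 * l ^+ 2)//; ring.
have ekn : (k ^+ n)^-1 <= expR (- (n%:R * (l - 2 * l ^+ 2))).
  rewrite expRN lef_pV2 ?posrE ?expR_gt0// mulrC expRM_natr.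
  by rewrite ler_pXn2r ?nnegrE ?expR_ge0 ?(ltW k0).
apply: le_trans (ler_wpM2r _ ekn) _; first by rewrite invr_ge0 expR_ge0.
rewrite -expRN -expRD ler_expR.
have ln : l * (4 * n%:R) = q by rewrite /l divfK// gt_eqF// mulr_gt0.
have -> : - a = - q ^+ 2 / (8 * n%:R) by rewrite q2; field; rewrite gt_eqF.
rewrite -ln le_eqVlt; apply/orP; left; apply/eqP; field.
by rewrite gt_eqF.
Qed.

(** Chernoff bound; [(1 + y / z)^r <= exp (r y / z)] is the only estimate. *)
Lemma proj_upper_tail (a : R) (r : nat) (P : 'M[R]_n) : 0 < a ->
  P^T = P -> P *m P = P -> (\rank P <= r)%N ->
  (mu [set x | ((Num.sqrt r%:R + Num.sqrt (2 * a)) ^+ 2 <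
     dotp (P *m vec x) (P *m vec x))%R] <= (expR (- a))%:E)%E.
Proof.
move=> a0 sP iP rP; set y := Num.sqrt (2 * a).
have y0 : 0 < y by rewrite sqrtr_gt0 mulr_gt0.
have y2 : y ^+ 2 = 2 * a by rewrite sqr_sqrtr// mulr_ge0// ltW.
have [r0|r0] := posnP r.
  have -> : P = 0 by apply/eqP; rewrite -mxrank_eq0 -leqn0 -r0.
  rewrite [X in mu X](_ : _ = set0) ?measure0 ?lee_fin ?expR_ge0//.
  apply/seteqP; split => x //=; rewrite mul0mx dotp0l.
  by rewrite ltNge sqr_ge0.
have rR : (0 : R) < r%:R by rewrite ltr0n.
set z := Num.sqrt r%:R.
have z0 : 0 < z by rewrite sqrtr_gt0.
have z2 : z ^+ 2 = r%:R by rewrite sqr_sqrtr// ltW.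
(* The minimiser of the Chernoff exponent: 1 - 2 l = r / (z + y)^2. *)
pose l := (1 - (z / (z + y)) ^+ 2) / 2.
have zy0 : 0 < z / (z + y) by rewrite divr_gt0// addr_gt0.
have zy1 : z / (z + y) < 1 by rewrite ltr_pdivrMr ?addr_gt0//; lra.
have l0 : 0 < l by rewrite /l; nra.
have l12 : l < 1 / 2 by rewrite /l; nra.
have CE : (Num.sqrt (1 - 2 * l))^-1 = 1 + y / z.
  rewrite (_ : 1 - 2 * l = (z / (z + y)) ^+ 2); last by rewrite /l; field;
    rewrite gt_eqF// addr_gt0.
  rewrite sqrtr_sqr gtr0_norm//; field; rewrite !gt_eqF// addr_gt0//.
have := @gaussian_projection_mgf R n mu l r P 0 gmu (ltW l0) l12 sP iP rP
  (mulmx0 _ _).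
rewrite dotp0l mul0r expR0 mulr1 CE => EP.
have mf : measurable_fun setT
  (fun x : n.-tuple R => expR
  (l * dotp (P *m vec x) (P *m vec x) + dotp 0 (vec x))).
  apply: measurableT_comp => //; apply: measurable_funD;
    last exact: measurable_dotp.
  by apply: measurable_funM => //; exact: measurable_sqnorm.
have := @markov_bound R _ _ mu _ (expR (l * (z + y) ^+ 2)) _
  [set x | (z + y) ^+ 2 < dotp (P *m vec x) (P *m vec x)] mf _ _ EP.
move=> /(_ _ _ _ _)/le_trans; apply.
- by move=> x; rewrite expR_ge0.
- by rewrite expR_gt0.
- apply: measurable_gt_set; exact: measurable_sqnorm.
- move=> x /= h; rewrite ler_expR dotp0l addr0.
  by rewrite ler_wpM2l ?ltW.
rewrite lee_fin ler_pdivrMr ?expR_gt0// -expRD.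
apply: (@le_trans _ _ (expR (y / z) ^+ r)).
  rewrite lerXn2r ?nnegrE ?expR_ge0 ?expR_ge1Dx// addr_ge0// divr_ge0// ltW//.
rewrite -expRM_natr ler_expR -z2.
have -> : y / z * z ^+ 2 = y * z by field; rewrite gt_eqF.
have -> : l * (z + y) ^+ 2 = z * y + y ^+ 2 / 2.
  by rewrite /l; field; rewrite gt_eqF// addr_gt0.
rewrite y2; lra.
Qed.

(** Only the order of magnitude of [|x|] matters here, so the exponent [1 / 4]
  suffices. *)
Lemma chi2_crude_tail (a : R) : 8 * a < n%:R ->
  (mu [set x | (16 * n%:R < sqn x)%R] <= (expR (- a))%:E)%E.
Proof.
move=> an.
have EP := @gaussian_projection_mgf R n mu (1/4) n 1%:M 0 gmu _ _ (trmx1 _ _)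
  (mulmx1 _) _ (mulmx0 _ _).
have l0 : (0 : R) <= 1 / 4 by lra.
have l12 : (1 : R) / 4 < 1 / 2 by lra.
move/(_ l0 l12) : EP; rewrite mxrank1 leqnn => /(_ isT).
rewrite dotp0l mul0r expR0 mulr1 => EP.
have mf : measurable_fun setT
  (fun x : n.-tuple R => expR
  (1 / 4 * dotp (1%:M *m vec x) (1%:M *m vec x) + dotp 0 (vec x))).
  apply: measurableT_comp => //; apply: measurable_funD;
    last exact: measurable_dotp.
  by apply: measurable_funM => //; exact: measurable_sqnorm.
have := @markov_bound R _ _ mu _ (expR (4 * n%:R)) _
  [set x | 16 * n%:R < sqn x] mf _ _ EP.
move=> /(_ _ _ _ _)/le_trans; apply.
- by move=> x; rewrite expR_ge0.
- by rewrite expR_gt0.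
- apply: measurable_gt_set; exact: measurable_sqn.
- move=> x /= h; rewrite ler_expR dotp0l addr0.
  by rewrite mul1mx -/(sqn x); lra.
rewrite lee_fin ler_pdivrMr ?expR_gt0// -expRD.
apply: (@le_trans _ _ (expR 1 ^+ n)); last first.
  by rewrite -expRM_natr ler_expR; have := ler0n R n; lra.
rewrite lerXn2r ?nnegrE ?expR_ge0 ?invr_ge0//.
apply: (@le_trans _ _ 2); last by have := expR_ge1Dx (1 : R); lra.
rewrite -[leRHS]invrK lef_pV2 ?posrE ?sqrtr_gt0//; last lra.
rewrite -[leLHS]gtr0_norm// -sqrtr_sqr ler_wsqrtr//; lra.
Qed.
End tails.

(** * Convexity of the hyperbolic cosine *)

Definition cosh (R : realType) (y : R) : R := (expR y + expR (- y)) / 2.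
Definition sinh (R : realType) (y : R) : R := (expR y - expR (- y)) / 2.

Lemma is_derive_cosh (R : realType) (y : R) : is_derive y 1 (@cosh R) (sinh y).
Proof.
have -> : @cosh R = 2^-1 \*: (expR \+ (expR \o -%R)).
  by apply/funext => x; rewrite /cosh /= mulrC.
apply: is_derive_eq.
rewrite /sinh /GRing.scale /=; lra.
Qed.

Lemma is_derive_sinh (R : realType) (y : R) : is_derive y 1 (@sinh R) (cosh y).
Proof.
have -> : @sinh R = 2^-1 \*: (expR \- (expR \o -%R)).
  by apply/funext => x; rewrite /sinh /= mulrC.
apply: is_derive_eq.
rewrite /cosh /GRing.scale /=; lra.
Qed.

Lemma cosh_gt0 (R : realType) (y : R) : 0 < cosh y.
Proof. by rewrite divr_gt0// addr_gt0 ?expR_gt0. Qed.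

Lemma coshN (R : realType) (y : R) : cosh (- y) = cosh y.
Proof. by rewrite /cosh opprK addrC. Qed.

Lemma sinhN (R : realType) (y : R) : sinh (- y) = - sinh y.
Proof. by rewrite /sinh opprK -mulNr opprB. Qed.

Lemma cosh0 (R : realType) : cosh 0 = 1 :> R.
Proof. by rewrite /cosh oppr0 expR0; lra. Qed.

Lemma sinh0 (R : realType) : sinh 0 = 0 :> R.
Proof. by rewrite /sinh oppr0 expR0; lra. Qed.

Lemma sinh_ge0 (R : realType) (y : R) : 0 <= y -> 0 <= sinh y.
Proof. by move=> y0; rewrite divr_ge0// subr_ge0 ler_expR; lra. Qed.

Lemma sinh_gt0 (R : realType) (y : R) : 0 < y -> 0 < sinh y.
Proof. by move=> y0; rewrite divr_gt0// subr_gt0 ltr_expR; lra. Qed.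

Lemma le_of_derive_ge0 (R : realType) (f f' : R -> R) (a b : R) :
  (forall x : R, is_derive x 1 f (f' x)) ->
    (forall x, a < x -> x < b -> 0 <= f' x) ->
  a <= b -> f a <= f b.
Proof.
move=> df f'0 ab; apply: (ger0_derive1_ndecr (a := a) (b := b));
  [move=> x _|move=> x| |exact: lexx|by []|exact: lexx].
- exact: ex_derive.
- by rewrite in_itv/= => /andP[ax xb]; rewrite derive1E derive_val f'0.
- apply: continuous_subspaceT => x; apply/differentiable_continuous.
  by apply/derivable1_diffP; exact: ex_derive.
Qed.

Lemma cosh_le (R : realType) (x y : R) : 0 <= x -> x <= y -> cosh x <= cosh y.
Proof.
move=> x0; apply: (le_of_derive_ge0 (@is_derive_cosh R)) => z xz _.
by rewrite sinh_ge0// (le_trans x0)// ltW.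
Qed.

Lemma sinh_le_mul_cosh (R : realType) (y : R) : 0 <= y -> sinh y <= y * cosh y.
Proof.
move=> y0; rewrite -subr_ge0.
have -> : 0 = (fun y : R => y * cosh y - sinh y) 0.
  by rewrite mul0r sinh0 subr0.
apply: (@le_of_derive_ge0 _ (fun y : R => y * cosh y - sinh y)
  (fun y => y * sinh y)) => //.
- move=> x; have dc := is_derive_cosh x; have ds := is_derive_sinh x.
  apply: is_derive_eq; rewrite /GRing.scale /=; lra.
- by move=> x x0 _; rewrite mulr_ge0 ?sinh_ge0 ?ltW.
Qed.

Lemma sinh_ratio (R : realType) (x y : R) :
  0 <= x -> x <= y -> y * sinh x <= x * sinh y.
Proof.
move=> x0 xy; rewrite -subr_ge0.
have -> : 0 = (fun y : R => x * sinh y - y * sinh x) x by rewrite subrr.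
apply: (@le_of_derive_ge0 _ (fun y : R => x * sinh y - y * sinh x)
  (fun y => x * cosh y - sinh x)) => //.
- move=> z; have ds := is_derive_sinh z.
  apply: is_derive_eq; rewrite /GRing.scale /=; lra.
- move=> z xz _; rewrite subr_ge0 (le_trans (sinh_le_mul_cosh x0))//.
  by rewrite ler_wpM2l ?cosh_le ?(ltW xz).
Qed.

(** [cosh] is a convex function of [y^2]: the derivative of the difference has
  the sign of [y0 * sinh y - y * sinh y0], and [sinh y / y] is nondecreasing
  ([sinh_ratio]). *)
Lemma cosh_tangent_pos (R : realType) (y y0 : R) : 0 <= y -> 0 < y0 ->
  cosh y0 + (y ^+ 2 - y0 ^+ 2) * (sinh y0 / (2 * y0)) <= cosh y.
Proof.
move=> yge0 y00; set k := sinh y0 / (2 * y0).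
have kE z : sinh z - 2 * z * k = (y0 * sinh z - z * sinh y0) / y0.
  by rewrite /k; field; rewrite gt_eqF.
have [y0y|/ltW yy0] := leP y0 y.
- pose f z := cosh z - z ^+ 2 * k.
  suff : f y0 <= f y by rewrite /f; nra.
  have df (z : R) : is_derive z 1 f (sinh z - 2 * z * k).
    have dc := is_derive_cosh z.
    apply: is_derive_eq; rewrite /GRing.scale /=; ring.
  apply: (le_of_derive_ge0 df) => // z y0z _.
  by rewrite kE divr_ge0 ?subr_ge0 ?sinh_ratio// ltW.
- pose f z := z ^+ 2 * k - cosh z.
  suff : f y <= f y0 by rewrite /f; nra.
  have df (z : R) : is_derive z 1 f (- (sinh z - 2 * z * k)).
    have dc := is_derive_cosh z.
    apply: is_derive_eq; rewrite /GRing.scale /=; ring.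
  apply: (le_of_derive_ge0 df) => // z yz zy0.
  rewrite kE -mulNr opprB divr_ge0 ?subr_ge0 ?sinh_ratio// ltW//.
  exact: le_lt_trans yz.
Qed.

(** The tangent at [x0] of the convex function [x |-> cosh (c * sqrt x)]. It
  is used with [x] the squared norm of a Gaussian vector and [c] a function of
  its direction. *)
Lemma cosh_sqrt_tangent (R : realType) (c x x0 : R) : 0 <= x -> 0 < x0 ->
  cosh (c * Num.sqrt x0) + (x - x0) *
    (c * sinh (c * Num.sqrt x0) / (2 * Num.sqrt x0))
  <= cosh (c * Num.sqrt x).
Proof.
move=> xge0 x00; have s0 : 0 < Num.sqrt x0 by rewrite sqrtr_gt0.
wlog c0 : c / 0 <= c.
  move=> h; have [/h//|/ltW c0] := leP 0 c.
  have /h : 0 <= - c by rewrite oppr_ge0.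
  by rewrite !mulNr !coshN sinhN ?mulrN ?mulNr ?opprK ?mulrN ?opprK.
move: c0; rewrite le_eqVlt => /predU1P[<-|c0].
  by rewrite !mul0r mulr0 addr0 lexx.
apply: le_trans (cosh_tangent_pos (mulr_ge0 (ltW c0) (sqrtr_ge0 x))
  (mulr_gt0 c0 s0)).
rewrite !exprMn !sqr_sqrtr ?(ltW x00)// le_eqVlt; apply/orP; left; apply/eqP.
by congr (_ + _); field; rewrite !gt_eqF.
Qed.

Lemma bernoulli_ineq (R : realType) (e : R) (n : nat) :
  0 <= e -> 1 + n%:R * e <= (1 + e) ^+ n.
Proof.
move=> e0; elim: n => [|n IH]; first by rewrite mul0r addr0.
rewrite exprS (le_trans _ (ler_wpM2l _ IH)) ?addr_ge0//.
rewrite -natr1; have : 0 <= n%:R * e ^+ 2 by rewrite mulr_ge0 ?sqr_ge0.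
nra.
Qed.

Lemma cosh_tangent (R : realType) (y y0 : R) :
  cosh y0 + (y - y0) * sinh y0 <= cosh y.
Proof.
have h1 : expR y0 * (1 + (y - y0)) <= expR y.
  rewrite -[y in leRHS](subrKC y0) expRD ler_wpM2l ?expR_ge0//;
    exact: expR_ge1Dx.
have h2 : expR (- y0) * (1 - (y - y0)) <= expR (- y).
  have -> : - y = - y0 + - (y - y0) by ring.
  by rewrite expRD ler_wpM2l ?expR_ge0//; exact: expR_ge1Dx.
by rewrite /cosh /sinh; lra.
Qed.

Lemma le_of_cosh_le (R : realType) (x y : R) :
  0 <= y -> cosh x <= cosh y -> `|x| <= y.
Proof.
move=> y0 xy; rewrite leNgt; apply/negP => yx.
have cx : cosh `|x| <= cosh y by case: (ger0P x) => _; rewrite ?coshN.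
have [y00|yp] := eqVneq y 0; last first.
  have s0 : 0 < sinh y by apply: sinh_gt0; rewrite lt_def yp.
  by have := cosh_tangent `|x| y; nra.
have x0 : 0 < `|x| by rewrite -y00.
have := expR_gt1Dx (lt0r_neq0 x0).
have := expR_ge1Dx (- `|x|).
move: cx; rewrite y00 cosh0 /cosh; lra.
Qed.

(** Signed weights are allowed because [cosh] is even. *)
Lemma cosh_jensen (R : realType) (k : nat) (w x : 'I_k -> R) :
  0 < \sum_(i < k) `|w i| ->
  cosh ((\sum_(i < k) w i * x i) / \sum_(i < k) `|w i|) <=
  (\sum_(i < k) `|w i| * cosh (x i)) / \sum_(i < k) `|w i|.
Proof.
set W := \sum_(i < k) `|w i| => W0; set z := _ / W.
rewrite ler_pdivlMr//.
have h i : `|w i| * cosh z + (w i * x i - `|w i| * z) * sinh z <=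
  `|w i| * cosh (x i).
  have [w0|w0] := ger0P (w i).
    by have := ler_wpM2l w0 (cosh_tangent (x i) z); lra.
  have := ler_wpM2l (ltW (_ : 0 < - w i)) (cosh_tangent (- x i) z).
  by rewrite coshN oppr_gt0 => /(_ w0); lra.
apply: le_trans (ler_sum _ (fun i _ => h i)).
rewrite big_split/= -!mulr_suml -/W sumrB -mulr_suml -/W.
have -> : \sum_(i < k) w i * x i = W * z by rewrite /z mulrC divfK// gt_eqF.
by rewrite subrr mul0r addr0 mulrC.
Qed.

Lemma sinh_le (R : realType) (x y : R) : 0 <= x -> x <= y -> sinh x <= sinh y.
Proof.
by move=> x0 xy; rewrite /sinh ler_pM2r// lerB// ler_expR//; lra.
Qed.

Lemma measurable_cosh (R : realType) : measurable_fun [set: R] (@cosh R).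
Proof.
apply: measurable_funM => //; apply: measurable_funD => //.
by apply: measurableT_comp => //.
Qed.

Lemma measurable_sinh (R : realType) : measurable_fun [set: R] (@sinh R).
Proof.
apply: measurable_funM => //; apply: measurable_funB => //.
by apply: measurableT_comp => //.
Qed.


(** The left side of the hypothesis does not depend on [w]: a single event
  controls all [w] that are dominated by the weights [h], up to their norm. *)
Lemma weighted_cosh_bound (R : realType) (k : nat) (w h x : 'I_k -> R)
  (m z : R) :
  0 < m -> 0 <= z ->
  (forall i, `|w i| <= h i * \sum_(i < k) `|w i|) ->
  \sum_(i < k) h i * cosh (m * x i) <= cosh (m * z) ->
  `|\sum_(i < k) w i * x i| <= z * \sum_(i < k) `|w i|.
Proof.
move=> m0 z0; set W := \sum_(i < k) `|w i| => wh hz.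
have W0 : 0 <= W by apply: sumr_ge0.
move: W0; rewrite le_eqVlt => /predU1P[W0|W0].
  have w0 i : w i = 0.
    move: (W0) => /esym/eqP; rewrite psumr_eq0// =>
      /allP/(_ i (mem_index_enum i)).
    by rewrite /= normr_eq0 => /eqP.
  by rewrite big1 ?normr0 -?W0 ?mulr0// => i _; rewrite w0 mul0r.
have := @cosh_jensen R k w (fun i => m * x i) W0; rewrite -/W => J.
have : cosh ((\sum_(i < k) w i * (m * x i)) / W) <= cosh (m * z).
  apply: le_trans J _; apply: le_trans hz.
  rewrite ler_pdivrMr// mulr_suml; apply: ler_sum => i _.
  rewrite mulrAC ler_wpM2r ?wh// ltW// cosh_gt0//.
move/(le_of_cosh_le (mulr_ge0 (ltW m0) z0)).
rewrite (_ : \sum_(i < k) _ = m * \sum_(i < k) w i * x i); last first.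
  by rewrite mulr_sumr; apply: eq_bigr => i _; rewrite mulrCA.
rewrite -mulrA normrM (gtr0_norm m0) ler_pM2l// normrM normfV (gtr0_norm W0).
by rewrite ler_pdivrMr.
Qed.

(** * The direction of a Gaussian vector *)

Section spherical.
Context (R : realType) (n : nat) (mu : probability (n.-tuple R) R)
  (gmu : standard_gaussian mu).

(** The cosine of the angle between [b] and [x], times the norm of [b]; the
  value at [x = 0] is 0. *)
Definition corr (b : 'cV[R]_n) (x : n.-tuple R) : R :=
  dotp b (vec x) / Num.sqrt (sqn x).

Lemma measurable_corr b : measurable_fun setT (corr b).
Proof.
rewrite (_ : corr b = fun x => dotp b (vec x) * ((sqn x) `^ 2^-1) `^ (-1)).
  apply: measurable_funM; first exact: measurable_dotp.
  apply: (measurableT_comp (measurable_powR _)).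
  by apply: (measurableT_comp (measurable_powR _)); exact: measurable_sqn.
by apply/funext => x; rewrite /corr powR12_sqrt ?sqn_ge0// powR_inv1//
  sqrtr_ge0.
Qed.

Lemma vec_dilate k (x : n.-tuple R) : vec (dilate k x) = k *: vec x.
Proof. by apply/colP => i; rewrite !mxE tnth_mktuple. Qed.

Lemma corr_dilate b k (x : n.-tuple R) :
  0 < k -> corr b (dilate k x) = corr b x.
Proof.
move=> k0; rewrite /corr /sqn vec_dilate !dotpZl !dotpZr mulrA -expr2.
rewrite sqrtrM ?sqr_ge0// sqrtr_sqr gtr0_norm//.
by rewrite invfM mulrACA divff ?gt_eqF// mul1r.
Qed.

Lemma corr_mul_norm b (x : n.-tuple R) :
  corr b x * Num.sqrt (sqn x) = dotp b (vec x).
Proof.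
have [s0|s0] := eqVneq (Num.sqrt (sqn x)) 0; last by rewrite /corr divfK.
rewrite s0 mulr0; move/eqP: s0; rewrite sqrtr_eq0 => s0.
have : sqn x == 0 by rewrite eq_le s0 sqn_ge0.
by rewrite dotp_eq0 => /eqP ->; rewrite dotp0r.
Qed.

Lemma corr_le b (x : n.-tuple R) : `|corr b x| <= Num.sqrt (dotp b b).
Proof.
have [s0|s0] := eqVneq (Num.sqrt (sqn x)) 0.
  by rewrite /corr s0 invr0 mulr0 normr0 sqrtr_ge0.
have s1 : 0 < Num.sqrt (sqn x) by rewrite lt_def s0 sqrtr_ge0.
rewrite /corr normrM normfV (gtr0_norm s1) ler_pdivrMr//.
exact: dotp_le_sqrt.
Qed.

Lemma integral_cosh_dotp (b : 'cV[R]_n) :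
  (\int[mu]_x (cosh (dotp b (vec x)))%:E = (expR (dotp b b / 2))%:E)%E.
Proof.
under eq_integral => x _.
  rewrite /cosh mulrDl EFinD (mulrC (expR _)) (mulrC (expR (- _))) !EFinM. over.
have me c : measurable_fun setT
  (fun x : n.-tuple R => (expR (dotp c (vec x)))%:E).
  apply/measurable_EFinP; apply: measurableT_comp => //; exact: measurable_dotp.
have meN c : measurable_fun setT
  (fun x : n.-tuple R => (expR (- dotp c (vec x)))%:E).
  by under eq_fun do rewrite -dotpNl; exact: me.
rewrite ge0_integralD//; last 2 first.
- by apply: emeasurable_funM => //; exact: me.
- by apply: emeasurable_funM => //; exact: meN.
rewrite !ge0_integralZl//.
under [X in (_ + _ * X)%E]eq_integral do rewrite -dotpNl.
rewrite !gaussian_dotp_mgf// dotpNl dotpNr opprK -!EFinM -EFinD.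
congr EFin; lra.
Qed.

(** Since [|x|^2] has mean [n] and is independent of the function [K] of the
  direction, the left side with [n] instead of [n - 1] would give equality.
  The weaker bound follows from [gaussian_dilation] for one [k] close to 1 and
  [1 - y <= exp (- y)]. *)
Lemma sqnorm_independent_lower (K : n.-tuple R -> R) (B : R) : (1 < n)%N ->
  measurable_fun setT K -> (forall x, 0 <= K x) -> (forall x, K x <= B) ->
  (forall k x, 0 < k -> K (dilate k x) = K x) ->
  ((n%:R - 1)%:E * \int[mu]_x (K x)%:E <= \int[mu]_x (sqn x * K x)%:E)%E.
Proof.
move=> n1 mK K0 KB Kh.
have nR : (0 : R) < n%:R by rewrite ltr0n ltnW.
have n2 : (2 : R) <= n%:R by rewrite ler_nat.
(* The method gives the factor (2 / (k^2 - 1)) * (1 - k^-n), which tends to n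
  as k decreases to 1; k = 1 + 1 / n^2 is close enough for n - 1. *)
pose e : R := (n%:R ^+ 2)^-1.
have e0 : 0 < e by rewrite invr_gt0 exprn_gt0.
pose k := 1 + e.
have k0 : 0 < k by rewrite /k; lra.
pose p := k ^+ n.
have p1 : 1 + n%:R^-1 <= p.
  have := @bernoulli_ineq R e n (ltW e0); rewrite /e -/k -/p.
  by rewrite (_ : n%:R * (n%:R ^+ 2)^-1 = n%:R^-1)//; field; rewrite gt_eqF.
have p0 : 0 < p by rewrite exprn_gt0.
pose dl := (k ^+ 2 - 1) / 2.
have dl0 : 0 < dl by rewrite /dl /k; nra.
have main : (n%:R - 1) * (p * dl) <= p - 1.
  suff : 1 <= p * (1 - (n%:R - 1) * dl) by lra.
  have q0 : 0 <= 1 - (n%:R - 1) * dl.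
    have -> : 1 - (n%:R - 1) * dl =
      (2 * n%:R ^+ 4 - (n%:R - 1) * (2 * n%:R ^+ 2 + 1)) / (2 * n%:R ^+ 4) :> R.
      by rewrite /dl /k /e; field; rewrite gt_eqF.
    rewrite divr_ge0 ?mulr_ge0 ?exprn_ge0 ?(ltW nR)//.
    set N := n%:R in nR n2 *; have h1 : N <= N ^+ 2 by rewrite expr2; nra.
    have -> : 2 * N ^+ 4 - (N - 1) * (2 * N ^+ 2 + 1) =
      2 * N ^+ 3 * (N - 1) + 2 * N ^+ 2 - N + 1 by ring.
    have : 0 <= 2 * N ^+ 3 *
      (N - 1) by rewrite !mulr_ge0 ?exprn_ge0 ?(ltW nR)//; lra.
    lra.
  apply: le_trans (ler_wpM2r q0 p1).
  have -> : (1 + n%:R^-1) * (1 - (n%:R - 1) * dl) =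
    1 + (n%:R ^+ 2 + 1) / (2 * n%:R ^+ 5) :> R.
    by rewrite /dl /k /e; field; rewrite gt_eqF.
  by rewrite lerDl divr_ge0 ?addr_ge0 ?mulr_ge0 ?exprn_ge0 ?(ltW nR).
have mEK : measurable_fun setT (EFin \o K) by exact/measurable_EFinP.
have IK0 : (0 <= \int[mu]_x (K x)%:E)%E by apply: integral_ge0 => x _;
  rewrite lee_fin.
have IKB : (\int[mu]_x (K x)%:E <= B%:E)%E.
  apply: (@le_trans _ _ (\int[mu]_x (cst B%:E x))%E).
    by apply: ge0_le_integral => // x _; rewrite ?lee_fin// (le_trans (K0 x)).
  rewrite integral_cst// -[leRHS]mule1 lee_wpmul2l//;
    last exact: probability_le1.
  have x0 : n.-tuple R by exact: [tuple 0 | i < n].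
  by rewrite lee_fin (le_trans (K0 x0)).
have [c cE] : exists c, (\int[mu]_x (K x)%:E)%E = c%:E.
  exists (fine (\int[mu]_x (K x)%:E)%E); rewrite fineK// ge0_fin_numE//.
  exact: le_lt_trans IKB (ltry _).
have c0 : 0 <= c by rewrite -lee_fin -cE.
have mE : measurable_fun setT (fun x : n.-tuple R => expR (- dl * sqn x)).
  by apply: measurableT_comp => //; apply: measurable_funM => //;
    exact: measurable_sqn.
have dil := @gaussian_dilation R n mu k K gmu k0 mK K0 (fun x => Kh k x k0).
have I2 : (p%:E * \int[mu]_x (K x)%:E <=
   \int[mu]_x (K x)%:E + (p * dl)%:E * \int[mu]_x (sqn x * K x)%:E)%E.
  have mS : measurable_fun setT (fun x : n.-tuple R => (sqn x * K x)%:E).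
    by apply/measurable_EFinP; apply: measurable_funM => //;
      exact: measurable_sqn.
  have S0 x : (0 <= (sqn x * K x)%:E)%E by rewrite lee_fin mulr_ge0 ?sqn_ge0.
  have K0' x : (0 <= (K x)%:E)%E by rewrite lee_fin.
  have pd0 : (0 <= (p * dl)%:E)%E by rewrite lee_fin mulr_ge0// ltW.
  have p0' : (0 <= p%:E)%E by rewrite lee_fin ltW.
  rewrite -[X in (_ <= X + _)%E]dil.
  rewrite -(ge0_integralZl mu measurableT mEK (fun x _ => K0' x) p0').
  rewrite -(ge0_integralZl mu measurableT mS (fun x _ => S0 x) pd0).
  have mD : measurable_fun setT (fun x : n.-tuple R =>
      (K x * (k ^+ n * expR (-
        (k ^+ 2 - 1) / 2 * \sum_(i < n) tnth x i ^+ 2)))%:E).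
    apply/measurable_EFinP; apply: measurable_funM => //;
      apply: measurable_funM => //.
    under eq_fun do rewrite sum_sqr_tnth.
    by apply: measurableT_comp => //; apply: measurable_funM => //;
      exact: measurable_sqn.
  have D0 x : (0 <= (K x *
    (k ^+ n * expR (- (k ^+ 2 - 1) / 2 * \sum_(i < n) tnth x i ^+ 2)))%:E)%E.
    by rewrite lee_fin !mulr_ge0 ?expR_ge0 ?exprn_ge0 ?(ltW k0).
  have mS' : measurable_fun setT
    (fun x : n.-tuple R => ((p * dl)%:E * (sqn x * K x)%:E)%E).
    exact: emeasurable_funM.
  rewrite -(ge0_integralD mu measurableT (fun x _ => D0 x) mD
    (fun x _ => mule_ge0 pd0 (S0 x)) mS').
  apply: ge0_le_integral => //.
  - by move=> x _; rewrite -EFinM lee_fin mulr_ge0 ?(ltW p0).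
  - exact: emeasurable_funM.
  - exact: emeasurable_funD.
  - move=> x _; rewrite -!EFinM -EFinD lee_fin sum_sqr_tnth -/p.
    rewrite (_ : - (k ^+ 2 - 1) / 2 = - dl); last by rewrite /dl; lra.
    have := expR_ge1Dx (- dl * sqn x).
    move=> /(ler_wpM2l (mulr_ge0 (ltW p0) (K0 x))).
    lra.
move: I2; rewrite cE -EFinM.
have : (0 <= \int[mu]_x (sqn x * K x)%:E)%E.
  by apply: integral_ge0 => x _; rewrite lee_fin mulr_ge0 ?sqn_ge0.
case: (\int[mu]_x (sqn x * K x)%:E)%E => [y| |] //=.
  rewrite -!EFinM -EFinD !lee_fin => y0 I2.
  rewrite -(ler_pM2l (mulr_gt0 p0 dl0)).
  have := ler_wpM2r c0 main; lra.
by move=> _ _; rewrite leey.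
Qed.
End spherical.

Section spherical.
Context (R : realType) (n : nat) (mu : probability (n.-tuple R) R)
  (gmu : standard_gaussian mu).

(** Jensen's inequality for [x |-> cosh (c * sqrt x)], which is convex, at the
  random point [|x|^2]: integrating [cosh_sqrt_tangent] at [x0 = n - 1], the
  linear term has nonnegative expectation by [sqnorm_independent_lower]. *)
Lemma spherical_cosh (m : R) (b : 'cV[R]_n) : (1 < n)%N ->
  (\int[mu]_x (cosh (m * corr b x))%:E <=
   (expR (m ^+ 2 * dotp b b / (2 * (n%:R - 1))))%:E)%E.
Proof.
move=> n1; have n2 : (2 : R) <= n%:R by rewrite ler_nat.
set x0 : R := n%:R - 1.
have x00 : 0 < x0 by rewrite /x0; lra.
set s := Num.sqrt x0.
have s0 : 0 < s by rewrite sqrtr_gt0.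
have s2 : s ^+ 2 = x0 by rewrite sqr_sqrtr// ltW.
pose c (x : n.-tuple R) := m / s * corr b x.
pose G (x : n.-tuple R) := cosh (c x * s).
pose K (x : n.-tuple R) := c x * sinh (c x * s) / (2 * s).
have mc : measurable_fun setT c by apply: measurable_funM => //;
  exact: measurable_corr.
have mcs : measurable_fun setT (fun x => c x * s) by exact: measurable_funM.
have mG : measurable_fun setT G by
  apply: (measurableT_comp (@measurable_cosh R)).
have mK : measurable_fun setT K.
  apply: measurable_funM => //; apply: measurable_funM => //.
  by apply: (measurableT_comp (@measurable_sinh R)).
have KE x : K x = `|c x| * sinh (`|c x| * s) / (2 * s).
  rewrite /K; case: (ger0P (c x)) => // _.
  by rewrite (mulNr (c x) s) sinhN mulrNN.
have K0 x : 0 <= K x.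
  rewrite KE; apply: divr_ge0; last by rewrite mulr_ge0// ltW.
  by apply: mulr_ge0 => //; apply: sinh_ge0; rewrite mulr_ge0// ltW.
pose B := `|m / s| * Num.sqrt (dotp b b).
have cB x : `|c x| <= B.
  by rewrite /c normrM ler_wpM2l// corr_le.
have KB x : K x <= B * sinh (B * s) / (2 * s).
  rewrite KE ler_pM2r; last by rewrite invr_gt0 mulr_gt0.
  apply: ler_pM => //; first by apply: sinh_ge0; rewrite mulr_ge0// ltW.
  by apply: sinh_le; [rewrite mulr_ge0// ltW | rewrite ler_wpM2r// ltW].
have Kh k x : 0 < k -> K (dilate k x) = K x by move=> k0;
  rewrite /K /c corr_dilate.
have := @sqnorm_independent_lower R n mu gmu K _ n1 mK K0 KB Kh.
rewrite -/x0 => IK.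
have csq x : c x * Num.sqrt (sqn x) = dotp ((m / s) *: b) (vec x).
  by rewrite /c -mulrA corr_mul_norm dotpZl.
have pw x : G x + sqn x * K x <= cosh (dotp ((m / s) *: b) (vec x)) + x0 * K x.
  have := cosh_sqrt_tangent (c x) (sqn_ge0 x) x00.
  by rewrite csq -/(G x) -/s -/(K x); lra.
have EC : (\int[mu]_x (cosh (dotp ((m / s) *: b) (vec x)))%:E =
    (expR (m ^+ 2 * dotp b b / (2 * x0)))%:E)%E.
  rewrite integral_cosh_dotp// dotpZl dotpZr -s2; congr (expR _)%:E.
  by field; rewrite gt_eqF.
rewrite -EC.
have mEG : measurable_fun setT (EFin \o G) by exact/measurable_EFinP.
have mEK : measurable_fun setT (EFin \o K) by exact/measurable_EFinP.
have mES : measurable_fun setT (fun x : n.-tuple R => (sqn x * K x)%:E).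
  by apply/measurable_EFinP; apply: measurable_funM => //;
    exact: measurable_sqn.
have mEC : measurable_fun setT
  (fun x : n.-tuple R => (cosh (dotp ((m / s) *: b) (vec x)))%:E).
  apply/measurable_EFinP; apply: (measurableT_comp (@measurable_cosh R)).
  exact: measurable_dotp.
have G0 x : (0 <= (G x)%:E)%E by rewrite lee_fin ltW ?cosh_gt0.
have C0 x : (0 <= (cosh (dotp ((m / s) *: b) (vec x)))%:E)%E by rewrite lee_fin
  ltW ?cosh_gt0.
have S0 x : (0 <= (sqn x * K x)%:E)%E by rewrite lee_fin mulr_ge0 ?sqn_ge0.
have EK0 x : (0 <= (K x)%:E)%E by rewrite lee_fin.
have x0E : (0 <= x0%:E)%E by rewrite lee_fin ltW.
have I1 : (\int[mu]_x (G x)%:E + \int[mu]_x (sqn x * K x)%:E <=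
    \int[mu]_x (cosh (dotp ((m / s) *: b) (vec x)))%:E + x0%:E * \int[mu]_x
      (K x)%:E)%E.
  rewrite -(ge0_integralZl mu measurableT mEK (fun x _ => EK0 x) x0E).
  rewrite -(ge0_integralD mu measurableT (fun x _ => G0 x) mEG
    (fun x _ => S0 x) mES).
  have mxK : measurable_fun setT
    (fun x : n.-tuple R => (x0%:E * (K x)%:E)%E) by exact: emeasurable_funM.
  rewrite -(ge0_integralD mu measurableT (fun x _ => C0 x) mEC
    (fun x _ => mule_ge0 x0E (EK0 x)) mxK).
  apply: ge0_le_integral => //.
  - by move=> x _; rewrite adde_ge0.
  - exact: emeasurable_funD.
  - exact: emeasurable_funD.
  - by move=> x _; rewrite -EFinM -!EFinD lee_fin.
have fK : (x0%:E * \int[mu]_x (K x)%:E)%E \is a fin_num.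
  rewrite fin_numM// ge0_fin_numE; last exact: integral_ge0.
  apply: (@le_lt_trans _ _
    (\int[mu]_x (cst (B * sinh (B * s) / (2 * s))%:E x))%E).
    apply: ge0_le_integral => // x _.
    by rewrite lee_fin KB.
  rewrite integral_cst//=;
    apply: (@le_lt_trans _ _ ((B * sinh (B * s) / (2 * s))%:E * 1)%E).
    rewrite lee_wpmul2l//; last exact: probability_le1.
    by rewrite lee_fin (le_trans (K0 [tuple 0 | i < n]))// KB.
  by rewrite mule1 ltry.
rewrite -(leeD2rE _ _ fK); apply: le_trans I1.
rewrite [X in (X + _ <= _)%E](_ : _ = \int[mu]_x (G x)%:E)%E;
  first exact: leeD2l.
apply: eq_integral => x _; congr (cosh _)%:E.
by rewrite /c; field; rewrite gt_eqF.
Qed.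

Lemma integral_wsum_cosh (k : nat) (b : 'I_k -> 'cV[R]_n) (h : 'I_k -> R)
  (m M : R) :
  (forall i, 0 <= h i) ->
  (forall i, (\int[mu]_x (cosh (m * corr (b i) x))%:E <= M%:E)%E) ->
  (\int[mu]_x (\sum_(i < k) h i * cosh (m * corr (b i) x))%:E <=
    ((\sum_(i < k) h i) * M)%:E)%E.
Proof.
move=> h0 hM.
have mE i : measurable_fun setT
  (fun x : n.-tuple R => (cosh (m * corr (b i) x))%:E).
  apply/measurable_EFinP; apply: (measurableT_comp (@measurable_cosh R)).
  by apply: measurable_funM => //; exact: measurable_corr.
under eq_integral => x _.
  rewrite -sumEFin; under eq_bigr do rewrite EFinM; over.
rewrite ge0_integral_sum//; last 2 first.
- by move=> i; exact: emeasurable_funM.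
- by move=> i x _; rewrite mule_ge0// lee_fin// ltW// cosh_gt0.
rewrite mulr_suml -sumEFin; apply: lee_sum => i _.
have C0 (x : n.-tuple R) :
  (0 <= (cosh (m * corr (b i) x))%:E)%E by rewrite lee_fin ltW// cosh_gt0.
have h0E : (0 <= (h i)%:E)%E by rewrite lee_fin.
rewrite (ge0_integralZl mu measurableT (mE i) (fun x _ => C0 x) h0E).
by rewrite EFinM lee_wpmul2l ?lee_fin.
Qed.

(** Markov's inequality with [1 / cosh y <= 2 * exp (- y)]; the parameter [(n
  - 1) / g * s] optimises the Gaussian exponent. *)
Lemma spherical_sup_tail (k : nat) (b : 'I_k -> 'cV[R]_n) (h : 'I_k -> R)
  (q g s : R) :
  (1 < n)%N -> (forall i, 0 <= h i) -> \sum_(i < k) h i <= q ->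
  0 < g -> (forall i, dotp (b i) (b i) <= g ^+ 2) ->
  (mu [set x | (cosh ((n%:R - 1) / g * s * (g * s)) <
      \sum_(i < k) h i * cosh ((n%:R - 1) / g * s * corr (b i) x))%R]
   <= (2 * q * expR (- ((n%:R - 1) * s ^+ 2 / 2)))%:E)%E.
Proof.
move=> n1 h0 hq g0 bg.
have n2 : (2 : R) <= n%:R by rewrite ler_nat.
set x0 : R := n%:R - 1; have x00 : 0 < x0 by rewrite /x0; lra.
set m := x0 / g * s.
have mg : m * (g * s) = x0 * s ^+ 2 by rewrite /m; field; rewrite gt_eqF.
have q0 : 0 <= q by rewrite (le_trans _ hq)// sumr_ge0.
have E1 i : (\int[mu]_x (cosh (m * corr (b i) x))%:E <=
  (expR (x0 * s ^+ 2 / 2))%:E)%E.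
  apply: le_trans (spherical_cosh m (b i) n1) _.
  rewrite -/x0 lee_fin ler_expR ler_pdivrMr ?mulr_gt0//.
  apply: le_trans (ler_wpM2l (sqr_ge0 m) (bg i)) _.
  by rewrite le_eqVlt /m; apply/orP; left; apply/eqP; field; rewrite gt_eqF.
have := integral_wsum_cosh h0 E1 => E2.
have mf : measurable_fun setT
  (fun x : n.-tuple R => \sum_(i < k) h i * cosh (m * corr (b i) x)).
  apply: measurable_sum => i; apply: measurable_funM => //.
  apply: (measurableT_comp (@measurable_cosh R)).
  by apply: measurable_funM => //; exact: measurable_corr.
have := @markov_bound R _ _ mu _ (cosh (m * (g * s))) _
  [set x | cosh (m * (g * s)) < \sum_(i < k) h i * cosh (m * corr (b i) x)] mf _
    _ E2.
move=> /(_ _ _ _ _)/le_trans; apply.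
- by move=> x; apply: sumr_ge0 => i _; rewrite mulr_ge0// ltW// cosh_gt0.
- exact: cosh_gt0.
- exact: measurable_gt_set.
- by move=> x /ltW.
rewrite lee_fin mg ler_pdivrMr ?cosh_gt0//.
apply: (@le_trans _ _ (q * expR (x0 * s ^+ 2 / 2))).
  by rewrite ler_wpM2r ?expR_ge0.
have -> : expR (x0 * s ^+ 2 / 2) =
  expR (- (x0 * s ^+ 2 / 2)) * expR (x0 * s ^+ 2).
  by rewrite -expRD; congr expR; field.
have hc : expR (x0 * s ^+ 2) <= 2 * cosh (x0 * s ^+ 2).
  by rewrite /cosh; have := expR_ge0 (- (x0 * s ^+ 2)); lra.
have := ler_wpM2l (mulr_ge0 q0 (expR_ge0 (- (x0 * s ^+ 2 / 2)))) hc.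
lra.
Qed.

End spherical.

(** * Auerbach weights *)

Definition replace_col (R : realType) (q : nat) (X : 'M[R]_q) (j : 'I_q)
  (y : 'cV[R]_q) : 'M[R]_q :=
  \matrix_(a, b) if b == j then y a 0 else X a b.

Lemma cramer (R : realType) (q : nat) (X : 'M[R]_q) (j : 'I_q) (y : 'cV[R]_q) :
  (\adj X *m y) j 0 = \det (replace_col X j y).
Proof.
rewrite mxE (expand_det_col _ j); apply: eq_bigr => i _.
rewrite !mxE eqxx mulrC; congr (_ * _).
rewrite /cofactor; congr (_ * \det _).
by apply/matrixP => a b;
  rewrite !mxE (negbTE (_ : lift j b != j)) ?neq_lift// eq_sym neq_lift.
Qed.

Lemma norm_det_le (R : realType) (q : nat) (X : 'M[R]_q) (M : R) :
  (forall a b, `|X a b| <= M) -> `|\det X| <= (q`!)%:R * M ^+ q.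
Proof.
move=> XM; apply: le_trans (ler_norm_sum _ _ _) _.
apply: (@le_trans _ _ (\sum_(s : 'S_q) M ^+ q)).
  apply: ler_sum => s _; rewrite normrMsign normr_prod.
  rewrite -[q in leRHS]card_ord -prodr_const; apply: ler_prod => i _.
  by rewrite normr_ge0 XM.
by rewrite sumr_const card_Sn mulr_natl.
Qed.

Lemma norm1_ge0 (R : realType) (k : nat) (v : 'cV[R]_k) : 0 <= norm1 v.
Proof. exact: sumr_ge0. Qed.

Lemma norm1Z (R : realType) (k : nat) (c : R) (v : 'cV[R]_k) :
  norm1 (c *: v) = `|c| * norm1 v.
Proof. by rewrite mulr_sumr; apply: eq_bigr => i _; rewrite mxE normrM. Qed.

Lemma norm1_0 (R : realType) (k : nat) : norm1 (0 : 'cV[R]_k) = 0.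
Proof. by rewrite /norm1 big1// => i _; rewrite mxE normr0. Qed.

Lemma coord_le_norm1 (R : realType) (k : nat) (v : 'cV[R]_k) i :
  `|v i 0| <= norm1 v.
Proof. by rewrite /norm1 (bigD1 i)//= lerDl sumr_ge0. Qed.

Section auerbach.
Context (R : realType) (k q : nat) (C : 'M[R]_(k, q)) (L : 'M[R]_(q, k))
  (LC : L *m C = 1%:M).

Let admissible (X : 'M[R]_q) := forall j, norm1 (C *m col j X) <= 1.

Let dets : set R := [set `|\det X| | X in admissible].

Let coord_bound (y : 'cV[R]_q) a : `|y a 0| <=
  (\sum_b \sum_i `|L b i|) * norm1 (C *m y).
Proof.
rewrite -[y in leLHS]mul1mx -LC -mulmxA mxE.
apply: le_trans (ler_norm_sum _ _ _) _.
apply: (@le_trans _ _ (\sum_i `|L a i| * norm1 (C *m y))).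
  by apply: ler_sum => i _; rewrite normrM ler_wpM2l// coord_le_norm1.
rewrite -mulr_suml ler_wpM2r ?norm1_ge0//.
by rewrite (bigD1 a)//= lerDl sumr_ge0// => b _; rewrite sumr_ge0.
Qed.

Let dets_ub : has_ubound dets.
Proof.
exists ((q`!)%:R * (\sum_b \sum_i `|L b i|) ^+ q) => _ [X aX <-].
apply: norm_det_le => a b.
have := coord_bound (col b X) a; rewrite mxE => /le_trans; apply.
by rewrite ler_piMr// sumr_ge0// => c _; rewrite sumr_ge0.
Qed.

Let dets_pos : exists2 d, dets d & 0 < d.
Proof.
pose S := 1 + \sum_j norm1 (C *m col j (1%:M : 'M[R]_q)).
have S1 : 1 <= S by rewrite lerDl sumr_ge0// => j _; rewrite norm1_ge0.
have S0 : 0 < S by rewrite (lt_le_trans ltr01).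
exists (`|\det ((S^-1)%:M : 'M[R]_q)|); last first.
  by rewrite det_scalar normr_gt0 expf_neq0// invr_neq0// gt_eqF.
exists (S^-1)%:M => // j.
rewrite -scalemx1 linearZ/= -scalemxAr norm1Z gtr0_norm ?invr_gt0//.
rewrite mulrC ler_pdivrMr// mul1r /S (bigD1 j)//= addrCA lerDl.
by rewrite addr_ge0// sumr_ge0// => i _; rewrite norm1_ge0.
Qed.

Let near_auerbach (dl : R) : 0 < dl -> dl < 1 ->
  exists h : 'I_k -> R, [/\ forall i, 0 <= h i, (1 - dl) * \sum_i h i <= q%:R &
    forall y i, `|(C *m y) i 0| <= h i * norm1 (C *m y)].
Proof.
move=> d0 d1; have [d1' dd d1p] := dets_pos.
have hs : has_sup dets by split; [exists d1' | exact: dets_ub].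
set s := sup dets.
have s0 : 0 < s by rewrite (lt_le_trans d1p)// ub_le_sup.
(* The coordinates with respect to the columns of a near-maximal X are quotients
  of determinants, hence at most 1 / (1 - dl). *)
have [_ [X aX <-] Xs] := sup_adherent (mulr_gt0 d0 s0) hs.
have dX : (1 - dl) * s < `|\det X| by rewrite mulrBl mul1r.
have d10 : 0 < 1 - dl by lra.
have detX : 0 < `|\det X| by rewrite (lt_trans _ dX)// mulr_gt0.
have uX : X \in unitmx by rewrite unitmxE unitfE -normr_gt0.
exists (fun i => (1 - dl)^-1 * \sum_j `|(C *m X) i j|); split.
  by move=> i; rewrite mulr_ge0 ?invr_ge0 ?(ltW d10)// sumr_ge0.
  rewrite -mulr_sumr mulrA divff ?gt_eqF// mul1r exchange_big/=.
  rewrite -[X in _ <= X%:R]card_ord -sumr_const; apply: ler_sum => j _.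
  apply: le_trans (aX j); rewrite le_eqVlt; apply/orP; left; apply/eqP.
  by apply: eq_bigr => i _;
    rewrite [in RHS]colE mulmxA -colE [X in _ = `|X|]mxE.
move=> y i.
have cb j : `|(invmx X *m y) j 0| <= (1 - dl)^-1 * norm1 (C *m y).
  have [N0|N0] := eqVneq (norm1 (C *m y)) 0.
    have -> : y = 0.
      apply/colP => a; rewrite [RHS]mxE; apply/eqP; rewrite -normr_le0.
      by apply: le_trans (coord_bound y a) _; rewrite N0 mulr0.
    by rewrite !mulmx0 mxE normr0 norm1_0 mulr0.
  have Np : 0 < norm1 (C *m y) by rewrite lt_def N0 norm1_ge0.
  pose z := (norm1 (C *m y))^-1 *: y.
  have yz : y = norm1 (C *m y) *: z by rewrite scalerA divff// scale1r.
  rewrite {1}yz -scalemxAr mxE normrM (gtr0_norm Np) mulrC ler_pM2r//.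
  rewrite /invmx uX -scalemxAl mxE cramer normrM normfV mulrC ler_pdivrMr//.
  apply: (@le_trans _ _ s).
    apply: ub_le_sup => //; exists (replace_col X j z) => // b.
    have [->|bj] := eqVneq b j.
      rewrite (_ : col j _ = z); last by apply/colP => a; rewrite !mxE eqxx.
      by rewrite /z -scalemxAr norm1Z gtr0_norm ?invr_gt0// mulVf.
    rewrite (_ : col b _ = col b X)//.
    by apply/colP => a; rewrite !mxE (negbTE bj).
  by rewrite mulrC ler_pdivlMr// mulrC ltW.
rewrite -{1}(mulKVmx uX y) (mulmxA C X) mxE.
apply: le_trans (ler_norm_sum _ _ _) _.
rewrite -mulrA mulrCA mulr_suml; apply: ler_sum => j _.
by rewrite normrM ler_wpM2l.
Qed.

(** The weight [h i] is the supremum of [|(C y)_i|] on the unit ball.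
  Near-maximal determinants give weights with total mass at most [q / (1 -
  dl)] that dominate these suprema, and [dl] is arbitrary. *)
Lemma auerbach_colfree : exists h : 'I_k -> R,
  [/\ forall i, 0 <= h i, \sum_i h i <= q%:R &
    forall y i, `|(C *m y) i 0| <= h i * norm1 (C *m y)].
Proof.
pose V i : set R := [set `|(C *m y) i 0| | y in [set y | norm1 (C *m y) <= 1]].
have V0 i : V i 0.
  by exists 0; rewrite /= ?mulmx0 ?mxE ?normr0// norm1_0 ler01.
have Vub i : has_ubound (V i).
  by exists 1 => _ [y /= y1 <-]; rewrite (le_trans (coord_le_norm1 _ _)).
exists (fun i => sup (V i)); split.
- by move=> i; apply: ub_le_sup.
- rewrite leNgt; apply/negP => qH.
  set H := \sum_i _ in qH.
  have H0 : 0 < H by rewrite (le_lt_trans _ qH).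
  pose dl := (H - q%:R) / (2 * H).
  have dl0 : 0 < dl by rewrite divr_gt0 ?subr_gt0// mulr_gt0.
  have q0 : (0 : R) <= q%:R by [].
  have dl1 : dl < 1 by rewrite ltr_pdivrMr ?mulr_gt0//; lra.
  have [h [h0 hq hV]] := near_auerbach dl0 dl1.
  have : H <= \sum_i h i.
    apply: ler_sum => i _; apply: ge_sup; first by exists 0.
    move=> _ [y /= y1 <-]; apply: le_trans (hV y i) _.
    by rewrite ler_piMr.
  move=> Hh.
  have : (1 - dl) * H <= q%:R by rewrite
    (le_trans _ hq)// ler_wpM2l// subr_ge0 ltW.
  have -> : (1 - dl) * H = (H + q%:R) / 2 by rewrite /dl; field; rewrite gt_eqF.
  lra.
- move=> y i.
  have [N0|N0] := eqVneq (norm1 (C *m y)) 0.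
    by rewrite N0 mulr0 -N0 coord_le_norm1.
  have Np : 0 < norm1 (C *m y) by rewrite lt_def N0 norm1_ge0.
  rewrite -ler_pdivrMr//; apply: ub_le_sup => //.
  exists ((norm1 (C *m y))^-1 *: y); rewrite /= -scalemxAr.
    by rewrite norm1Z gtr0_norm ?invr_gt0// mulVf.
  by rewrite mxE normrM gtr0_norm ?invr_gt0// mulrC.
Qed.
End auerbach.

(** Auerbach's lemma in the form needed for the noise: the sum over [i] of the
  largest values of [|(A v)_i|] on the unit ball of [norm1 (A v)] is at most
  the rank of [A], whatever the number of rows. *)
Lemma auerbach (R : realType) (k n : nat) (A : 'M[R]_(k, n)) : exists h :
  'I_k -> R,
  [/\ forall i, 0 <= h i, \sum_i h i <= (\rank A)%:R &
    forall (v : 'cV[R]_n) i, `|(A *m v) i 0| <= h i * norm1 (A *m v)].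
Proof.
have /row_fullP[L LC] := col_base_full A.
have [h [h0 hq hb]] := auerbach_colfree LC.
exists h; split => // v i.
by have := hb (row_base A *m v) i; rewrite mulmxA mulmx_base.
Qed.

(** * Deterministic oracle inequality *)

Lemma norm1D (R : realType) (k : nat) (u v : 'cV[R]_k) :
  norm1 (u + v) <= norm1 u + norm1 v.
Proof. by rewrite -big_split; apply: ler_sum => i _; rewrite mxE ler_normD. Qed.

Lemma norm1B (R : realType) (k : nat) (u v : 'cV[R]_k) :
  norm1 (u - v) <= norm1 u + norm1 v.
Proof.
by rewrite (le_trans (norm1D _ _))// -scaleN1r norm1Z normrN1 mul1r.
Qed.

Lemma norm1_rows (R : realType) (m n : nat) (D : 'M[R]_(m, n)) (S : {set 'I_m})
  (u : 'cV[R]_n) :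
  norm1 (rows D S *m u) = \sum_(i in S) `|(D *m u) i 0|.
Proof.
rewrite big_enum_val; apply: eq_bigr => i _; congr `|_|.
by rewrite !mxE; apply: eq_bigr => j _; rewrite mxE.
Qed.

Lemma norm1_split (R : realType) (m n : nat) (D : 'M[R]_(m, n)) (S : {set 'I_m})
  (u : 'cV[R]_n) :
  norm1 (D *m u) = norm1 (rows D S *m u) + norm1 (rows D (~: S)%SET *m u).
Proof.
rewrite !norm1_rows /norm1 (bigID (fun i => i \in S))/=; congr (_ + _).
by apply: eq_bigl => i; rewrite inE.
Qed.

Section geometry.
Context (R : realType) (n : nat).
Implicit Types u v w : 'cV[R]_n.

Lemma normn_ge0 u : 0 <= normn u. Proof. exact: sqrtr_ge0. Qed.

Lemma normnE u : normn u = Num.sqrt (dotp u u) / Num.sqrt n%:R.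
Proof.
rewrite /normn -mulr_suml sqrtrM; last by apply: sumr_ge0 => i _;
  rewrite sqr_ge0.
by rewrite sqrtrV ?ler0n//; congr (Num.sqrt _ / _); apply: eq_bigr => i _;
  rewrite expr2.
Qed.

Lemma normn_sqr u : normn u ^+ 2 = dotp u u / n%:R.
Proof. by rewrite normnE exprMn exprVn !sqr_sqrtr ?dotp_ge0 ?ler0n. Qed.

Lemma normnZ c u : normn (c *: u) = `|c| * normn u.
Proof.
rewrite !normnE dotpZl dotpZr mulrA -expr2 sqrtrM ?sqr_ge0// sqrtr_sqr.
by rewrite mulrA.
Qed.

Lemma normnN u : normn (- u) = normn u.
Proof. by rewrite -scaleN1r normnZ normrN1 mul1r. Qed.

Lemma dotp_le_normn u v : dotp u v / n%:R <= normn u * normn v.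
Proof.
rewrite !normnE mulrACA -invfM -expr2 sqr_sqrtr ?ler0n//.
rewrite ler_wpM2r ?invr_ge0 ?ler0n//.
exact: le_trans (ler_norm _) (dotp_le_sqrt u v).
Qed.

Lemma normnD_sqr u v :
  normn (u + v) ^+ 2 = normn u ^+ 2 + 2 * (dotp u v / n%:R) + normn v ^+ 2.
Proof.
rewrite !normn_sqr dotpDl !dotpDr (dotpC v u); lra.
Qed.

Lemma normnD u v : normn (u + v) <= normn u + normn v.
Proof.
rewrite -(@ler_pXn2r _ 2) ?nnegrE ?addr_ge0 ?normn_ge0// normnD_sqr.
have := dotp_le_normn u v; nra.
Qed.

End geometry.

Section estimator.
Context (R : realType) (m n : nat) (D : 'M[R]_(m, n)) (S : {set 'I_m})
  (f0 eps fhat : 'cV[R]_n) (lambda0 eta pi0 c : R) (P : 'M[R]_n).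
Let A := rows D (~: S)%SET.
Hypotheses (l0 : 0 < lambda0) (eta0 : 0 < eta) (eta1 : eta < 1)
  (hfhat : sqrt_analysis_estimator D lambda0 (f0 + eps) fhat)
  (noise : forall v : 'cV[R]_n, dotp eps v / n%:R <=
     normn (P *m eps) * normn v +
     (1 - eta) * lambda0 * normn eps * norm1 (A *m v))
  (pi_ge0 : 0 <= pi0) (pi_lt : pi0 < eta / 2)
  (Ppi : normn (P *m eps) <= pi0 * normn eps)
  (cE : c ^+ 2 + 4 * c = (eta / 2 - pi0) ^+ 2)
  (hDf0 : lambda0 * norm1 (D *m f0) <= c * normn eps)
  (epos : 0 < normn eps).

Let norm1_A (u : 'cV[R]_n) : norm1 (A *m u) <= norm1 (D *m u).
Proof. by rewrite (norm1_split D S) lerDr norm1_ge0. Qed.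

(** If the error were larger than [eta * normn eps], some point of the segment
  from [f0] to [fhat] would have error exactly [eta * normn eps] and a
  criterion not larger than that of [f0]. There the residual is still at least
  [(1 - eta) * normn eps], so the penalty absorbs the noise, and what remains
  contradicts the choice of [c]. *)
Lemma estimation_error_small : normn (fhat - f0) <= eta * normn eps.
Proof.
have ep := epos; have hd := hDf0.
set e := normn eps in ep hd *; set tau := normn _.
rewrite leNgt; apply/negP => etau.
(* Otherwise the bound on norm1 (D *m f0) would be negative. *)
have c0 : 0 <= c.
  rewrite -(pmulr_lge0 _ ep); apply: le_trans hd.
  by rewrite mulr_ge0 ?norm1_ge0 ?ltW.
have tau0 : 0 < tau by rewrite (lt_trans _ etau)// mulr_gt0.
(* The point f0 + t v of the segment has error exactly eta * e. *)
pose t := eta * e / tau.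
have t0 : 0 < t by rewrite divr_gt0// mulr_gt0.
have t1 : t < 1 by rewrite ltr_pdivrMr// mul1r.
set v := fhat - f0 in tau etau tau0 t t0 t1 *.
have tv : normn (t *: v) =
  eta * e by rewrite normnZ gtr0_norm// /t divfK// gt_eqF.
set e1 := normn (eps - t *: v).
have e1_ge : (1 - eta) * e <= e1.
  have := normnD (eps - t *: v) (t *: v); rewrite subrK tv -/e -/e1; lra.
set d0 := lambda0 * norm1 (D *m f0).
set d1 := lambda0 * norm1 (D *m (f0 + t *: v)).
have d0_ge0 : 0 <= d0 by rewrite mulr_ge0 ?norm1_ge0 ?ltW.
have d1_ge0 : 0 <= d1 by rewrite mulr_ge0 ?norm1_ge0 ?ltW.
have d0c : d0 <= c * e by exact: hDf0.
have conv : e1 + d1 <= e + d0.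
  have h := hfhat f0.
  rewrite (addrC f0) addrK -/e (_ : eps + f0 - fhat = eps - v) in h; last first.
    by rewrite /v opprB addrA.
  have h1 : e1 <= (1 - t) * e + t * normn (eps - v).
    rewrite /e1 (_ : eps - t *: v = (1 - t) *: eps + t *: (eps - v)).
      apply: le_trans (normnD _ _) _.
      by rewrite !normnZ !gtr0_norm ?subr_gt0.
    by rewrite scalerBl scale1r [in RHS](scalerBr t eps v) addrA subrK.
  have h2 : norm1 (D *m (f0 + t *: v)) <=
    (1 - t) * norm1 (D *m f0) + t * norm1 (D *m fhat).
    rewrite (_ : f0 + t *: v = (1 - t) *: f0 + t *: fhat).
      rewrite mulmxDr -!scalemxAr; apply: le_trans (norm1D _ _) _.
      by rewrite !norm1Z !gtr0_norm ?subr_gt0.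
    by rewrite /v scalerBl scale1r scalerBr addrA addrAC.
  have := ler_wpM2l (ltW l0) h2; rewrite -/d1 mulrDr !(mulrCA lambda0) -/d0.
  have := ler_wpM2l (ltW t0) h; rewrite -/d0; lra.
have nz := noise (t *: v); rewrite tv -/e in nz.
have Av : lambda0 * norm1 (A *m (t *: v)) <= d1 + d0.
  rewrite (_ : t *: v = (f0 + t *: v) - f0); last by rewrite addrAC subrr add0r.
  rewrite mulmxBr /d1 /d0 -mulrDr ler_pM2l//.
  by apply: le_trans (norm1B _ _) _; rewrite lerD ?norm1_A.
have Av0 : 0 <= lambda0 * norm1
  (A *m (t *: v)) by rewrite mulr_ge0 ?norm1_ge0 ?ltW.
have sq : e1 ^+ 2 = e ^+ 2 - 2 * (dotp eps (t *: v) / n%:R) + (eta * e) ^+ 2.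
  by rewrite /e1 normnD_sqr normnN tv dotpNr -/e; lra.
have Pe : normn (P *m eps) * (eta * e) <= pi0 * e * (eta * e).
  by rewrite ler_wpM2r// mulr_ge0 ?ltW.
have nz2 : dotp eps (t *: v) / n%:R <=
  pi0 * e * (eta * e) + (1 - eta) * e * (d1 + d0).
  apply: le_trans nz _; apply: lerD => //.
  rewrite (_ : _ * _ * _ * _ =
    (1 - eta) * e * (lambda0 * norm1 (A *m (t *: v)))); last by ring.
  by rewrite ler_wpM2l// mulr_ge0 ?subr_ge0 ?ltW.
have e1_ub : e1 <= (1 + c) * e by lra.
have key : (eta * e) ^+ 2 <=
  2 * (pi0 * e * (eta * e)) + 2 * ((1 - eta) * e * (d1 + d0)) + (e1 + e) *
  (d0 - d1).
  have : (e1 - e) * (e1 + e) <= (d0 - d1) * (e1 + e).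
    by rewrite ler_wpM2r// ?addr_ge0 ?normn_ge0//; lra.
  nra.
have key2 : (eta * e) ^+ 2 <=
  2 * (pi0 * e * (eta * e)) + d0 * (2 * (1 - eta) * e + e1 + e).
  have : 0 <= d1 * (e1 + e - 2 * (1 - eta) * e).
    rewrite mulr_ge0//; have : 0 < eta * e by rewrite mulr_gt0.
    lra.
  lra.
have key3 : d0 * (2 * (1 - eta) * e + e1 + e) <=
  (c * e) * ((2 * (1 - eta) + (1 + c) + 1) * e).
  apply: ler_pM => //; last lra.
  rewrite !addr_ge0 ?normn_ge0 ?mulr_ge0 ?subr_ge0 ?ltW//.
have : eta ^+ 2 * e ^+ 2 <=
  (2 * pi0 * eta + c * (4 - 2 * eta + c)) * e ^+ 2 by nra.
rewrite ler_pM2r ?exprn_gt0//.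
have : 0 <= eta * c by rewrite mulr_ge0// ltW.
have pl := pi_lt; have pg := pi_ge0; have eg := eta0.
(* By the choice of c, the difference of the two sides is at least
  (eta / 2 - pi0) * (3 * eta / 2 + pi0). *)
have : 0 < (eta / 2 - pi0) * (3 * eta / 2 + pi0) by apply: mulr_gt0; lra.
have ce := cE; move=> h0 h1 h2; lra.
Qed.

Let ehat := f0 + eps - fhat.

Lemma residual_bounds :
  (1 - eta) * normn eps <= normn ehat <= (1 + eta) * normn eps.
Proof.
have h := estimation_error_small.
have E : eps = ehat + (fhat - f0).
  by rewrite /ehat addrA subrK addrAC subrr add0r.
have E2 : ehat = eps - (fhat - f0) by rewrite [in RHS]E addrK.
have := normnD ehat (fhat - f0); rewrite -E.
have := normnD eps (- (fhat - f0)); rewrite -E2 normnN.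
by move=> h1 h2; apply/andP; split; lra.
Qed.

(** First order condition along the segment from [fhat] to [f]. The derivative
  of the norm at the nonzero residual is bounded through [2 * e * N <= e^2 +
  N^2], so that only quotients of quadratic expressions occur. *)
Lemma optimality (f : 'cV[R]_n) : 0 < normn ehat ->
  dotp ehat (f - fhat) / n%:R <=
    normn ehat * lambda0 * (norm1 (D *m f) - norm1 (D *m fhat)).
Proof.
set e := normn ehat => e_gt0; set w := f - fhat.
set ip := dotp ehat w / n%:R; set dd := norm1 (D *m f) - _.
rewrite leNgt; apply/negP => hlt.
pose gap := ip - e * lambda0 * dd.
have gap0 : 0 < gap by rewrite subr_gt0.
pose W := normn w ^+ 2.
have W0 : 0 <= W by exact: sqr_ge0.
have step (t : R) : 0 < t -> t <= 1 -> 2 * gap <= t * W.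
  move=> t0 t1.
  have h := hfhat (fhat + t *: w).
  rewrite opprD addrA -/ehat -/e in h.
  have h2 : norm1 (D *m (fhat + t *: w)) <= norm1 (D *m fhat) + t * dd.
    rewrite (_ : fhat + t *: w = (1 - t) *: fhat + t *: f); last first.
      by rewrite /w scalerBl scale1r scalerBr addrA addrAC.
    rewrite mulmxDr -!scalemxAr; apply: le_trans (norm1D _ _) _.
    by rewrite !norm1Z !ger0_norm ?subr_ge0 ?(ltW t0)// /dd; lra.
  have h3 := ler_wpM2l (ltW l0) h2.
  set N := normn (ehat - t *: w) in h.
  have N2 : N ^+ 2 = e ^+ 2 - 2 * t * ip + t ^+ 2 * W.
    rewrite /N normnD_sqr normnN normnZ exprMn real_normK ?num_real// dotpNr
      dotpZr.
    by rewrite -/e -/W /ip; lra.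
  have h4 : 2 * e * N <= e ^+ 2 + N ^+ 2 by have := sqr_ge0 (e - N); nra.
  have h5 : e <= N + lambda0 * (t * dd) by lra.
  have h6 : 2 * e * e <= 2 * e *
    (N + lambda0 * (t * dd)) by rewrite ler_wpM2l// mulr_ge0// ltW.
  rewrite -(ler_pM2l t0) /gap; nra.
have h1 := step 1 ltr01 (lexx 1).
have WW : 0 < W by lra.
have := step (gap / W); rewrite divr_gt0// => /(_ isT).
rewrite ler_pdivrMr// mul1r divfK ?gt_eqF//.
by have := h1; lra.
Qed.

(** The polarisation identity for [fhat - f0] and [fhat - f] produces the
  inner products with the noise and with the residual; the former is bounded
  by [noise], the latter by [optimality]. *)
Lemma oracle_inequality (f : 'cV[R]_n) :
  normn (fhat - f0) ^+ 2 + 2 * (1 - eta) * lambda0 * normn eps * norm1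
    (rows D S *m fhat)
  <= normn (f - f0) ^+ 2 + normn
    (P *m eps) ^+ 2 + 4 * lambda0 * normn eps * norm1 (D *m f).
Proof.
have /andP[lb ub] := residual_bounds.
have ehat0 : 0 < normn ehat by rewrite (lt_le_trans _ lb)// mulr_gt0// subr_gt0.
have opt := optimality f ehat0.
have nz := noise (fhat - f).
have Av : norm1 (A *m (fhat - f)) <= norm1 (A *m fhat) + norm1 (A *m f).
  by rewrite mulmxBr norm1B.
have Af := norm1_A f.
have spl := norm1_split D S fhat; rewrite -/A in spl.
have id : normn (fhat - f0) ^+ 2 + normn (fhat - f) ^+ 2 = normn (f - f0) ^+ 2
    + 2 * (dotp eps (fhat - f) / n%:R) + 2 * (dotp ehat (f - fhat) / n%:R).
  have -> : f - f0 = (fhat - f0) + (f - fhat) by rewrite [RHS]addrC addrA subrK.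
  rewrite (normnD_sqr (fhat - f0) (f - fhat)) -(normnN (f - fhat)) opprB.
  have -> : dotp ehat (f - fhat) =
    - dotp ehat (fhat - f) by rewrite -dotpNr opprB.
  have -> : dotp (fhat - f0) (f - fhat) =
    - dotp (fhat - f0) (fhat - f) by rewrite -dotpNr opprB.
  have -> : fhat - f0 = eps - ehat.
    by rewrite /ehat opprB [RHS]addrCA opprD (addrCA eps) subrr addr0.
  by rewrite dotpDl dotpNl; lra.
have amgm := sqr_ge0 (normn (P *m eps) - normn (fhat - f)).
have e1 : 0 <= 1 - eta by rewrite subr_ge0 ltW.
have le0 : 0 <= lambda0 * normn eps by rewrite mulr_ge0 ?ltW.
have x1 : (1 - eta) * lambda0 * normn eps * norm1 (A *m (fhat - f)) <=
   (1 - eta) * lambda0 * normn eps * (norm1 (A *m fhat) + norm1 (A *m f)).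
  by rewrite ler_wpM2l// -mulrA mulr_ge0.
have x2 : (1 - eta) * lambda0 * normn eps * norm1 (A *m f) <=
  (1 - eta) * lambda0 * normn eps * norm1 (D *m f).
  by rewrite ler_wpM2l// -mulrA mulr_ge0.
have x3 : (1 - eta) * normn eps * (lambda0 * norm1 (D *m fhat)) <=
  normn ehat * (lambda0 * norm1 (D *m fhat)).
  by rewrite ler_wpM2r// mulr_ge0 ?norm1_ge0 ?ltW.
have x4 : normn ehat * (lambda0 * norm1 (D *m f)) <=
  (1 + eta) * normn eps * (lambda0 * norm1 (D *m f)).
  by rewrite ler_wpM2r// mulr_ge0 ?norm1_ge0 ?ltW.
rewrite spl in x3 opt.
nra.
Qed.

End estimator.

(** * The noise *)

(** [1 - A^+ A] is the orthogonal projector onto the kernel of [A]. *)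
Lemma kernel_projector (R : realType) (k n : nat) (A : 'M[R]_(k, n)) :
  let P := 1%:M - mpinv A *m A in
  [/\ P^T = P, P *m P = P & (\rank P <= nullity A)%N].
Proof.
have [a1 a2 a3 a4] := mpinvP A; set X := mpinv A in a1 a2 a3 a4 *.
have XAP : X *m A *m (X *m A) = X *m A by rewrite mulmxA a2.
have sP : (1%:M - X *m A)^T = 1%:M - X *m A by rewrite linearB/= trmx1 a4.
split => //.
  by rewrite mulmxBl mul1mx mulmxBr mulmx1 XAP subrr subr0.
rewrite -mxrank_tr /nullity; apply: mxrankS; apply/sub_kermxP.
by rewrite -trmx_mul mulmxBr mulmx1 mulmxA a1 subrr trmx0.
Qed.

Lemma rank_nullity (R : realType) (k n : nat) (A : 'M[R]_(k, n)) :
  n%:R - (nullity A)%:R = (\rank A)%:R :> R.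
Proof.
rewrite /nullity mxrank_ker mxrank_tr natrB ?rank_leq_col//; lra.
Qed.

Lemma dotp_decomp (R : realType) (k n : nat) (A : 'M[R]_(k, n))
  (e v : 'cV[R]_n) :
  dotp e v = dotp ((1%:M - mpinv A *m A) *m e) v +
    \sum_(i < k) (A *m v) i 0 * dotp (col i (mpinv A)) e.
Proof.
have [sP _ _] := kernel_projector A.
rewrite -{1}sP -dotp_mulmx mulmxBl mul1mx dotpDr dotpNr.
rewrite -mulmxA [in X in _ = _ + X](_ : \sum_i _ =
  dotp e (mpinv A *m (A *m v))).
  by rewrite subrK.
rewrite dotp_mulmx /dotp; apply: eq_bigr => i _.
rewrite mulrC; congr (_ * _); rewrite mxE; apply: eq_bigr => j _.
by rewrite !mxE.
Qed.

Lemma col_le_gamma (R : realType) (m n : nat) (D : 'M[R]_(m, n))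
  (S : {set 'I_m}) i :
  normn (col i (mpinv (rows D (~: S)%SET))) <= gamma_ D S.
Proof. by rewrite /gamma_ (bigD1 i)//= le_max lexx. Qed.

Section reduction.
Context (R : realType) (d : measure_display) (T : measurableType d)
  (P : probability T R) (n : nat) (sigma : R) (hsigma : 0 < sigma)
  (eps : 'I_n -> {RV P >-> R}) (heps : gaussian_noise sigma eps).

Definition standardized (w : T) : n.-tuple R := [tuple eps i w / sigma | i < n].

Lemma measurable_standardized : measurable_fun setT standardized.
Proof.
apply/measurable_fun_tnthP => i.
rewrite (_ : _ \o _ = fun w => eps i w / sigma).
  by apply: measurable_funM.
by apply/funext => w /=; rewrite tnth_mktuple.
Qed.

HB.instance Definition _ :=
  isMeasurableFun.Build _ _ _ _ standardized measurable_standardized.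

Lemma standardized_gaussian :
  standard_gaussian (distribution P
    [the {mfun T >-> n.-tuple R} of standardized]).
Proof.
move=> B mB.
have mB' i : measurable [set y : R | B i (y / sigma)].
  have mdiv : measurable_fun [set: R]
    (fun y : R => y / sigma) by exact: measurable_funM.
  by have := mdiv measurableT _ (mB i); rewrite setTI.
rewrite /distribution /pushforward /=.
transitivity (P (\bigcap_(i in [set: 'I_n])
  (eps i @^-1` [set y | B i (y / sigma)]))).
  congr (P _); apply/seteqP; split => w /=.
    by move=> h i _ /=; have := h i; rewrite tnth_mktuple.
  by move=> h i; have := h i I; rewrite tnth_mktuple.
rewrite heps//; apply: eq_bigr => i _.
rewrite (normal_prob_scale hsigma (mB' i)); congr (normal_prob _ _ _).
apply/seteqP; split => y /=; by rewrite mulrAC divff ?gt_eqF// mul1r.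
Qed.

Lemma noise_vecE w : noise_vec eps w = sigma *: vec (standardized w).
Proof.
by apply/colP => i; rewrite !mxE tnth_mktuple mulrC divfK// gt_eqF.
Qed.

End reduction.

(** The exponent in [spherical_sup_tail] is [ln (2 q) + t] for this [s], where
  [q] is the rank of [A], so that the factor [2 q] cancels. *)
Lemma dictionary_noise_event (R : realType) (n k : nat) (A : 'M[R]_(k, n))
    (mu : probability (n.-tuple R) R) (g t : R) :
  standard_gaussian mu -> (1 < n)%N -> 0 < t ->
  (forall i, normn (col i (mpinv A)) <= g) ->
  let s := Num.sqrt ((2 * ln (2 * (\rank A)%:R) + 2 * t) / (n%:R - 1)) in
  exists E : set (n.-tuple R), [/\ measurable E, (mu E <= (expR (- t))%:E)%E &
    forall x, ~ E x -> forall w : 'cV[R]_n,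
      \sum_(i < k) (A *m w) i 0 * dotp (col i (mpinv A)) (vec x) / n%:R
      <= g * s * normn (vec x) * norm1 (A *m w)].
Proof.
move=> gmu n1 t0 hg s.
have n2 : (2 : R) <= n%:R by rewrite ler_nat.
have n0 : (0 : R) < n%:R by lra.
(* Without positive g all columns of the pseudoinverse vanish, and the event is
  void; otherwise g' is a bound on their Euclidean norms. *)
have [g0|g0] := leP g 0.
  exists set0; split => // [|x _ w]; first by rewrite measure0 lee_fin expR_ge0.
  have b0 i : col i (mpinv A) = 0.
    apply/eqP; rewrite -dotp_eq0; have : normn (col i (mpinv A)) = 0.
      by apply/eqP; rewrite eq_le normn_ge0 (le_trans (hg i)).
    move/(congr1 (fun z => z ^+ 2)); rewrite normn_sqr expr0n/= => /eqP.
    by rewrite mulf_eq0 invr_eq0 (gt_eqF n0) orbF.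
  rewrite big1 => [|i _]; last by rewrite b0 dotp0l mulr0 mul0r.
  case: (posnP k) => [k0|k0].
    by rewrite [norm1 _]big1 ?mulr0// => i; have := ltn_ord i; rewrite {2}k0.
  have -> : g = 0.
    apply/eqP; rewrite eq_le g0 (le_trans _ (hg (Ordinal k0)))//;
      exact: normn_ge0.
  by rewrite !mul0r.
have [h [h0 hq hA]] := auerbach A.
pose b i := col i (mpinv A).
pose g' := g * Num.sqrt n%:R.
have sn : 0 < Num.sqrt (n%:R : R) by rewrite sqrtr_gt0.
have g'0 : 0 < g' by rewrite mulr_gt0.
have bg i : dotp (b i) (b i) <= g' ^+ 2.
  have := hg i; rewrite -(@ler_pXn2r _ 2) ?nnegrE ?normn_ge0 ?(ltW g0)//.
  by rewrite normn_sqr ler_pdivrMr// /g' exprMn sqr_sqrtr// ltW.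
(* For rank 0 this uses that ln 0 is 0. *)
have lnq : 0 <= ln (2 * (\rank A)%:R) :> R.
  case: (\rank A) => [|q]; first by rewrite mulr0 ln0.
  by rewrite ln_ge0// -natrM ler1n.
have n1' : 0 < n%:R - 1 :> R by lra.
have s0 : 0 < s by rewrite sqrtr_gt0 divr_gt0//; lra.
have s2 : (n%:R - 1) * s ^+ 2 / 2 = ln (2 * (\rank A)%:R) + t.
  rewrite sqr_sqrtr; last by rewrite divr_ge0 ?(ltW n1')//; lra.
  by field; rewrite gt_eqF.
pose m := (n%:R - 1) / g' * s.
have m0 : 0 < m by rewrite !mulr_gt0 ?invr_gt0.
exists [set x | cosh (m * (g' * s)) <
  \sum_(i < k) h i * cosh (m * corr (b i) x)].
split.
- apply: measurable_gt_set; apply: measurable_sum => i;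
    apply: measurable_funM => //.
  apply: (measurableT_comp (@measurable_cosh R)).
  by apply: measurable_funM => //; exact: measurable_corr.
- apply: le_trans (spherical_sup_tail gmu s n1 h0 hq g'0 bg) _.
  rewrite lee_fin s2 opprD expRD mulrA.
  have [r0|r0] := posnP (\rank A).
    by rewrite r0 mulr0 !mul0r expR_ge0.
  by rewrite (expRN (ln _)) lnK ?posrE ?mulr_gt0 ?ltr0n// divff ?mul1r//
    gt_eqF// mulr_gt0 ?ltr0n.
move=> x /negP; rewrite -leNgt => xE w.
have := weighted_cosh_bound (w := fun i => (A *m w) i 0) m0
  (ltW (mulr_gt0 g'0 s0)) (hA w) xE.
rewrite -/(norm1 (A *m w)) => hb.
have -> : \sum_(i < k) (A *m w) i 0 * dotp (b i) (vec x) / n%:R =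
    (\sum_(i < k) (A *m w) i 0 * corr (b i) x) * (Num.sqrt (sqn x) / n%:R).
  rewrite mulr_suml; apply: eq_bigr => i _.
  by rewrite mulrA -[in RHS](mulrA _ (corr _ _)) corr_mul_norm.
apply: (@le_trans _ _ (g' * s * norm1 (A *m w) * (Num.sqrt (sqn x) / n%:R))).
  rewrite ler_wpM2r ?divr_ge0 ?sqrtr_ge0 ?ler0n//.
  exact: le_trans (ler_norm _) hb.
rewrite normnE -/(sqn x) le_eqVlt; apply/orP; left; apply/eqP.
rewrite /g' -{2}(sqr_sqrtr (ler0n R n)); field.
by rewrite gt_eqF.
Qed.

Lemma probability_setC_union_bound (R : realType) (d : measure_display)
  (T : measurableType d)
    (mu : probability T R) (E1 E2 E3 E4 : set T) (p q : R) :
  measurable E1 -> measurable E2 -> measurable E3 -> measurable E4 ->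
  (mu E1 <= p%:E)%E -> (mu E2 <= p%:E)%E -> (mu E3 <= p%:E)%E ->
    (mu E4 <= q%:E)%E ->
  ((1 - 3 * p - q)%:E <= mu (~` (E1 `|` E2 `|` E3 `|` E4)))%E.
Proof.
move=> m1 m2 m3 m4 h1 h2 h3 h4.
have mU : measurable (E1 `|` E2 `|` E3 `|` E4) by do !apply: measurableU.
have hU : (mu (E1 `|` E2 `|` E3 `|` E4) <= (3 * p + q)%:E)%E.
  have U2 (B C : set T) : measurable B -> measurable C ->
    (mu (B `|` C) <= mu B + mu C)%E.
    exact: measureU2.
  have m12 : measurable (E1 `|` E2) by exact: measurableU.
  have m123 : measurable (E1 `|` E2 `|` E3) by exact: measurableU.
  apply: (le_trans (U2 _ _ m123 m4)).
  apply: (@le_trans _ _ (p%:E + p%:E + p%:E + q%:E)%E); last first.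
    by rewrite -!EFinD lee_fin; lra.
  apply: leeD => //; apply: (le_trans (U2 _ _ m12 m3)).
  by apply: leeD => //; apply: (le_trans (U2 _ _ m1 m2)); exact: leeD.
rewrite probability_setC//.
have fU : mu (E1 `|` E2 `|` E3 `|` E4) \is a fin_num by exact: fin_num_measure.
move: hU fU; case: (mu (E1 `|` E2 `|` E3 `|` E4)) => [u| |]// hU _.
by rewrite -EFinB lee_fin; move: hU; rewrite lee_fin; lra.
Qed.

Theorem theorem3p2 (R : realType)
  (d : measure_display) (T : measurableType d) (P : probability T R)
  (n m : nat) (f0 : 'cV[R]_n) (sigma : R) (hsigma : 0 < sigma)
  (eps : 'I_n -> {RV P >-> R}) (heps : gaussian_noise sigma eps)
  (D : 'M[R]_(m, n)) (S : {set 'I_m}) (hS : active_sets D S)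
  (a eta t lambda0 Rb : R)
  (ha : 0 < a) (heta0 : 0 < eta) (heta1 : eta < 1)
  (ht0 : 0 < t)
  (ht1 : t < (n%:R - 1) / 2 - ln (2 * (n%:R - (r_ D S)%:R)))
  (hlambda0 : 0 < lambda0)
  (hlambda : 1 / (1 - eta) * gamma_ D S
     * Num.sqrt ((2 * ln (2 * (n%:R - (r_ D S)%:R)) + 2 * t) / (n%:R - 1))
     <= lambda0)
  (hn : 8 * a < n%:R)
  (hRb : 0 < Rb) (hlambdaR : Rb / (1 - eta) <= lambda0)
  (c : R)
  (hc : c = Num.sqrt
     ((eta / 2 - (Num.sqrt (r_ D S)%:R + Num.sqrt (2 * a))
                 / Num.sqrt (n%:R - Num.sqrt (8 * a * n%:R))) ^+ 2 + 4) - 2)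
  (hDf0 : norm1 (D *m f0)
     <= c * sigma * Num.sqrt (1 - Num.sqrt (8 * a / n%:R)) / lambda0)
  (hetaS : 2 * ((Num.sqrt (r_ D S)%:R + Num.sqrt (2 * a))
                / Num.sqrt (n%:R - Num.sqrt (8 * a * n%:R))) < eta)
  (fhat : T -> 'cV[R]_n)
  (hfhat : forall w : T,
     sqrt_analysis_estimator D lambda0 (f0 + noise_vec eps w) (fhat w)) :
  forall f : 'cV[R]_n,
    with_proba_ge P (1 - 4 * expR (- a) - expR (- t))
      [set w | normn (fhat w - f0) ^+ 2
               + 2 * (1 - eta) * Num.sqrt (1 - Num.sqrt (8 * a / n%:R))
                 * sigma * lambda0 * norm1 (rows D S *m fhat w)
               <= normn (f - f0) ^+ 2
                  + sigma ^+ 2 / n%:R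
                    * (Num.sqrt (2 * a) + Num.sqrt (r_ D S)%:R) ^+ 2
                  + 16 * sigma * lambda0 * norm1 (D *m f)].
Proof.
move=> f.
set r := r_ D S in ht1 hlambda hc hetaS *.
set A := rows D (~: S)%SET.
have [sP iP rP] := kernel_projector A.
set P0 := 1%:M - mpinv A *m A in sP iP rP.
have qE : n%:R - r%:R = (\rank A)%:R :> R by exact: rank_nullity.
rewrite qE in ht1 hlambda.
have lnq : 0 <= ln (2 * (\rank A)%:R) :> R.
  case: (\rank A) => [|q]; first by rewrite mulr0 ln0.
  by rewrite ln_ge0// -natrM ler1n.
have n1 : (1 < n)%N by rewrite -(ltr1n R); lra.
have n2 : (2 : R) <= n%:R by rewrite ler_nat.
have n0 : (0 : R) < n%:R by lra.
pose X := [the {mfun T >-> n.-tuple R} of standardized sigma eps].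
pose mu := distribution P X.
have gmu : standard_gaussian mu by exact: standardized_gaussian.
have [E4 [mE4 pE4 hE4]] :=
  dictionary_noise_event gmu n1 ht0 (@col_le_gamma R m n D S).
pose E1 := [set x : n.-tuple R | sqn x < n%:R - Num.sqrt (8 * a * n%:R)].
pose E2 := [set x : n.-tuple R | 16 * n%:R < sqn x].
pose E3 := [set x : n.-tuple R | (Num.sqrt r%:R + Num.sqrt (2 * a)) ^+ 2 <
  dotp (P0 *m vec x) (P0 *m vec x)].
have pE1 : (mu E1 <= (expR (- a))%:E)%E by apply: chi2_lower_tail => //;
  exact: ltnW.
have pE2 : (mu E2 <= (expR (- a))%:E)%E by exact: chi2_crude_tail.
have pE3 : (mu E3 <= (expR (- a))%:E)%E by exact: proj_upper_tail.
have mE1 : measurable E1 by apply: measurable_lt_set; exact: measurable_sqn.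
have mE2 : measurable E2 by apply: measurable_gt_set; exact: measurable_sqn.
have mE3 : measurable E3 by apply: measurable_gt_set; exact: measurable_sqnorm.
(* Norm too small, norm too large, projection too large, dictionary noise too
  large. *)
exists (X @^-1` ~` (E1 `|` E2 `|` E3 `|` E4)); split.
- rewrite -[X in measurable X]setTI;
    apply: (measurable_standardized sigma eps) => //.
  by apply: measurableC; do !apply: measurableU.
- move=> w /= wE.
  set x : n.-tuple R := standardized sigma eps w.
  have [nE1 nE2 nE3 nE4] : [/\ ~ E1 x, ~ E2 x, ~ E3 x & ~ E4 x].
    by split=> h; apply: wE;
      [left; left; left|left; left; right|left; right|right].
  move: nE1 nE2 nE3 => /negP; rewrite -leNgt => x1 /negP; rewrite -leNgt =>
    x2 /negP; rewrite -leNgt => x3.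
  have := hfhat w; rewrite (noise_vecE hsigma) -/x; set e := sigma *: vec x =>
    hmin.
  set l := Num.sqrt (1 - Num.sqrt (8 * a / n%:R)) in hDf0 *.
  have qn : Num.sqrt (8 * a * n%:R) = Num.sqrt (8 * a / n%:R) * n%:R.
    have -> : 8 * a * n%:R = 8 * a / n%:R * n%:R ^+ 2 by field; rewrite gt_eqF.
    rewrite sqrtrM; last by rewrite divr_ge0 ?mulr_ge0// ltW.
    by rewrite sqrtr_sqr ger0_norm// ltW.
  have q1 : Num.sqrt (8 * a / n%:R) < 1.
    by rewrite -[ltRHS]sqrtr1 ltr_sqrt ?ltr_pdivrMr ?mul1r.
  have l0 : 0 < l by rewrite sqrtr_gt0 subr_gt0.
  have l2 : l ^+ 2 = 1 - Num.sqrt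
    (8 * a / n%:R) by rewrite sqr_sqrtr// subr_ge0 ltW.
  have sq : Num.sqrt (n%:R - Num.sqrt (8 * a * n%:R)) = Num.sqrt n%:R * l.
    by rewrite -sqrtrM ?ler0n// qn; congr Num.sqrt; ring.
  have sn : 0 < Num.sqrt (n%:R : R) by rewrite sqrtr_gt0.
  set y := Num.sqrt r%:R + Num.sqrt (2 * a) in hc hetaS x3 *.
  have y0 : 0 <= y by rewrite addr_ge0 ?sqrtr_ge0.
  set pi0 := y / _ in hc hetaS.
  have piE : pi0 = y / (Num.sqrt n%:R * l) by rewrite /pi0 sq.
  have pi_ge0 : 0 <= pi0 by rewrite piE divr_ge0// mulr_ge0 ?ltW.
  have cE : c ^+ 2 + 4 * c = (eta / 2 - pi0) ^+ 2.
    have : (c + 2) ^+ 2 = (eta / 2 - pi0) ^+ 2 + 4.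
      by rewrite hc subrK sqr_sqrtr// addr_ge0// sqr_ge0.
    lra.
  have c0 : 0 <= c.
    rewrite hc subr_ge0 -[leLHS]gtr0_norm// -sqrtr_sqr ler_wsqrtr//.
    by have := sqr_ge0 (eta / 2 - pi0); lra.
  have normx : normn (vec x) =
    Num.sqrt (sqn x) / Num.sqrt n%:R by rewrite normnE.
  have norme : normn e = sigma * normn (vec x) by rewrite normnZ gtr0_norm.
  have e_lb : sigma * l <= normn e.
    rewrite norme ler_pM2l// normx ler_pdivlMr// mulrC -sq.
    by rewrite ler_wsqrtr.
  have e_ub : normn e <= 4 * sigma.
    rewrite norme mulrC ler_pM2r// normx ler_pdivrMr//.
    rewrite -[4]gtr0_norm// -sqrtr_sqr -sqrtrM ?sqr_ge0// ler_wsqrtr//.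
    by rewrite (_ : 4 ^+ 2 = 16 :> R)//; ring.
  have epos : 0 < normn e by rewrite (lt_le_trans _ e_lb)// mulr_gt0.
  have Pe : normn (P0 *m e) <= sigma * (y / Num.sqrt n%:R).
    rewrite -scalemxAr normnZ gtr0_norm// ler_pM2l// normnE ler_pM2r
      ?invr_gt0//.
    by rewrite -[y]ger0_norm// -sqrtr_sqr ler_wsqrtr.
  have Ppi : normn (P0 *m e) <= pi0 * normn e.
    apply: le_trans Pe _; apply: le_trans (ler_wpM2l pi_ge0 e_lb).
    by rewrite piE le_eqVlt; apply/orP; left; apply/eqP; field; rewrite !gt_eqF.
  have hDf0' : lambda0 * norm1 (D *m f0) <= c * normn e.
    move: hDf0; rewrite ler_pdivlMr// mulrC => /le_trans; apply.
    by rewrite -mulrA ler_wpM2l.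
  have noise v : dotp e v / n%:R <= normn (P0 *m e) * normn v +
      (1 - eta) * lambda0 * normn e * norm1 (A *m v).
    rewrite (dotp_decomp A) mulrDl; apply: lerD; first exact: dotp_le_normn.
    have := hE4 x nE4 v; set s := Num.sqrt _ => hs.
    have gs : gamma_ D S * s <= (1 - eta) * lambda0.
      move: hlambda; rewrite -/s mul1r -mulrA -ler_pdivlMl ?invr_gt0
        ?subr_gt0//.
      by rewrite invrK.
    have -> : (\sum_(i < #|(~: S)%SET|) (A *m v) i 0 * dotp (col i (mpinv A)) e)
      / n%:R
       = sigma * \sum_(i < #|(~: S)%SET|) (A *m v) i 0 * dotp (col i (mpinv A))
         (vec x) / n%:R.
      rewrite mulr_suml mulr_sumr; apply: eq_bigr => i _; rewrite dotpZr; ring.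
    apply: le_trans (ler_wpM2l (ltW hsigma) hs) _.
    rewrite norme (_ : sigma *
      (gamma_ D S * s * normn (vec x) * norm1 (A *m v)) =
      gamma_ D S * s * (sigma * normn (vec x)) * norm1 (A *m v)); last by ring.
    rewrite ler_wpM2r ?norm1_ge0// ler_wpM2r// mulr_ge0 ?normn_ge0// ltW//.
  have pi_lt : pi0 < eta / 2 by lra.
  have := oracle_inequality hlambda0 heta0 heta1 hmin noise pi_ge0 pi_lt Ppi cE
    hDf0' epos f.
  have PP : normn (P0 *m e) ^+ 2 <=
    sigma ^+ 2 / n%:R * (Num.sqrt (2 * a) + Num.sqrt r%:R) ^+ 2.
    rewrite (addrC (Num.sqrt (2 * a))) -/y.
    have -> : sigma ^+ 2 / n%:R * y ^+ 2 = (sigma * (y / Num.sqrt n%:R)) ^+ 2.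
      rewrite !exprMn exprVn sqr_sqrtr ?ler0n//; ring.
    have h0 : 0 <= sigma * (y / Num.sqrt n%:R).
      by apply: mulr_ge0; [exact: ltW | rewrite divr_ge0// ltW].
    by rewrite ler_pXn2r ?nnegrE ?normn_ge0.
  have L1 : 2 * (1 - eta) * l * sigma * lambda0 * norm1 (rows D S *m fhat w) <=
      2 * (1 - eta) * lambda0 * normn e * norm1 (rows D S *m fhat w).
    rewrite ler_wpM2r ?norm1_ge0//.
    rewrite (_ : 2 * (1 - eta) * l * sigma * lambda0 =
      2 * (1 - eta) * lambda0 * (sigma * l)); last by ring.
    by rewrite ler_wpM2l// !mulr_ge0 ?subr_ge0 ?ltW.
  have L2 : 4 * lambda0 * normn e * norm1 (D *m f) <=
    16 * sigma * lambda0 * norm1 (D *m f).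
    rewrite ler_wpM2r ?norm1_ge0//.
    have := ler_wpM2l (ltW hlambda0) e_ub; lra.
  lra.
- apply: le_trans (probability_setC_union_bound mE1 mE2 mE3 mE4 pE1 pE2 pE3
    pE4).
  by rewrite lee_fin; have := expR_ge0 (- a); lra.
Qed.
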